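(* Let $\mu,\nu\in\mathbb{H}$ satisfy $\mu^2=\nu^2=-1$ and $\mu\nu+\nu\mu=0$, let $\mathcal{F}^{\mu,\nu}$ be the associated left quaternion Fourier transform, and let $f,g:\mathbb{R}^2\to\mathbb{H}$ be integrable quaternion functions. Then the classical convolution of $f$ and $g$ is expressed in terms of Mustard convolutions by $$\begin{aligned} f*g=\frac14\Big[&f*_{\mu,\nu}g+f*_{\mu,\nu}g^{(0,1)}+f*_{\mu,\nu}g^{(1,0)}+f*_{\mu,\nu}g^{(1,1)}\\ &-\nu f*_{\mu,\nu}\nu g+\nu f*_{\mu,\nu}\nu g^{(0,1)}-\nu f*_{\mu,\nu}\nu g^{(1,0)}+\nu f*_{\mu,\nu}\nu g^{(1,1)}\\ &-\mu f^{(0,1)}*_{\mu,\nu}\mu g-\mu f^{(0,1)}*_{\mu,\nu}\mu g^{(0,1)}+\mu f^{(0,1)}*_{\mu,\nu}\mu g^{(1,0)}+\mu f^{(0,1)}*_{\mu,\nu}\mu g^{(1,1)}\\ &+\nu\mu f^{(0,1)}*_{\mu,\nu}\mu\nu g-\nu\mu f^{(0,1)}*_{\mu,\nu}\mu\nu g^{(0,1)}-\nu\mu f^{(0,1)}*_{\mu,\nu}\mu\nu g^{(1,0)}+\nu\mu f^{(0,1)}*_{\mu,\nu}\mu\nu g^{(1,1)}\Big]. \end{aligned}$$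
   Context: $\mathbb{H}$ is the algebra of real quaternions. Quaternion functions are functions $f=f_0+f_1\boldsymbol{i}+f_2\boldsymbol{j}+f_3\boldsymbol{k}:\mathbb{R}^2\to\mathbb{H}$ with $f_0,f_1,f_2,f_3\in L^1(\mathbb{R}^2)$ real-valued; equalities between such functions are almost everywhere. For $q\in\mathbb{H}$, $qf$ is the pointwise left multiple. Parentheses are omitted: $\nu f*_{\mu,\nu}\nu g^{(0,1)}$ means $(\nu f)*_{\mu,\nu}(\nu g^{(0,1)})$, and similarly for all terms. Reflections: for $\phi=(\phi_1,\phi_2)\in\{0,1\}^2$, $f^{\phi}(x)=f((-1)^{\phi_1}x_1,(-1)^{\phi_2}x_2)$. Exponential: for $\mu^2=-1$ and $\theta\in\mathbb{R}$, $e^{\mu\theta}=\cos\theta+\mu\sin\theta$. Left quaternion Fourier transform: $\mathcal{F}^{\mu,\nu}(f)(y)=\frac{1}{2\pi}\int_{\mathbb{R}^2}e^{-\mu x_1y_1}e^{-\nu x_2y_2}f(x)\,dx$. Its inverse is formally $(\mathcal{F}^{\mu,\nu})^{-1}(h)(y)=\frac1{2\pi}\int_{\mathbb{R}^2}e^{\nu x_2y_2}e^{\mu x_1y_1}h(x)\,dx$. Classical convolution: $(f*g)(x)=\int_{\mathbb{R}^2}f(y)g(x-y)\,dy$ (quaternion product in the integrand). Mustard convolution: $f*_{\mu,\nu}g:=2\pi(\mathcal{F}^{\mu,\nu})^{-1}\big(\mathcal{F}^{\mu,\nu}(f)\,\mathcal{F}^{\mu,\nu}(g)\big)$, with the pointwise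 quaternion product. For integrable $f,g$ this is understood as the unique integrable quaternion function $h$ with $\mathcal{F}^{\mu,\nu}(h)=2\pi\,\mathcal{F}^{\mu,\nu}(f)\mathcal{F}^{\mu,\nu}(g)$ (such an $h$ always exists). *)

(* Defs.v *)
From HB Require Import structures.
From mathcomp Require Import all_boot all_order all_algebra ring.
From mathcomp Require Import all_classical all_reals all_analysis.

Set Implicit Arguments.
Unset Strict Implicit.
Unset Printing Implicit Defensive.

Import Order.TTheory GRing.Theory Num.Theory.

Local Open Scope classical_set_scope.
Local Open Scope ring_scope.

(* [Quat a b c d] is the real quaternion a + b i + c j + d k. *)
Record quat (R : realType) : Type :=
  Quat { qre : R; qi : R; qj : R; qk : R }.

Definition quat_encode (R : realType) (p : quat R) : R * R * R * R :=
  (qre p, qi p, qj p, qk p).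
Definition quat_decode (R : realType) (t : R * R * R * R) : quat R :=
  let: (a, b, c, d) := t in Quat a b c d.
Lemma quat_encodeK (R : realType) :
  cancel (@quat_encode R) (@quat_decode R).
Proof. by case. Qed.

HB.instance Definition _ (R : realType) :=
  Choice.copy (quat R) (can_type (@quat_encodeK R)).

Section QuatAlgebra.
Context {R : realType}.
Implicit Types p q r : quat R.

Definition addq p q : quat R :=
  Quat (qre p + qre q) (qi p + qi q) (qj p + qj q) (qk p + qk q).

Definition oppq p : quat R := Quat (- qre p) (- qi p) (- qj p) (- qk p).

Fact addqA : associative addq.
Proof. by case=> ? ? ? ? [? ? ? ?] [? ? ? ?]; rewrite /addq /= !addrA. Qed.

Fact addqC : commutative addq.
Proof. by case=> ? ? ? ? [? ? ? ?]; congr Quat; rewrite /= addrC. Qed.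

Fact add0q : left_id (Quat 0 0 0 0) addq.
Proof. by case=> ? ? ? ?; rewrite /addq /= !add0r. Qed.

Fact addNq : left_inverse (Quat 0 0 0 0) oppq addq.
Proof. by case=> ? ? ? ?; rewrite /addq /= !addNr. Qed.

HB.instance Definition _ :=
  GRing.isZmodule.Build (quat R) addqA addqC add0q addNq.

(* Hamilton product: i^2 = j^2 = k^2 = i j k = -1. *)
Definition mulq p q : quat R :=
  Quat (qre p * qre q - qi p * qi q - qj p * qj q - qk p * qk q)
       (qre p * qi q + qi p * qre q + qj p * qk q - qk p * qj q)
       (qre p * qj q - qi p * qk q + qj p * qre q + qk p * qi q)
       (qre p * qk q + qi p * qj q - qj p * qi q + qk p * qre q).

Fact mulqA : associative mulq.
Proof. by case=> ? ? ? ? [? ? ? ?] [? ? ? ?]; congr Quat => /=; ring. Qed.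

Fact mul1q : left_id (Quat 1 0 0 0) mulq.
Proof. by case=> ? ? ? ?; congr Quat => /=; ring. Qed.

Fact mulq1 : right_id (Quat 1 0 0 0) mulq.
Proof. by case=> ? ? ? ?; congr Quat => /=; ring. Qed.

Fact mulqDl : left_distributive mulq addq.
Proof. by case=> ? ? ? ? [? ? ? ?] [? ? ? ?]; congr Quat => /=; ring. Qed.

Fact mulqDr : right_distributive mulq addq.
Proof. by case=> ? ? ? ? [? ? ? ?] [? ? ? ?]; congr Quat => /=; ring. Qed.

Fact oneq_neq0 : Quat 1 0 0 0 != 0 :> quat R.
Proof. by apply/eqP => -[] /eqP; rewrite oner_eq0. Qed.

HB.instance Definition _ := GRing.Zmodule_isNzRing.Build (quat R)
  mulqA mul1q mulq1 mulqDl mulqDr oneq_neq0.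

Definition scaleq (a : R) p : quat R :=
  Quat (a * qre p) (a * qi p) (a * qj p) (a * qk p).

Fact scaleqA a b p : scaleq a (scaleq b p) = scaleq (a * b) p.
Proof. by rewrite /scaleq /= !mulrA. Qed.

Fact scale1q : left_id 1 scaleq.
Proof. by case=> ? ? ? ?; rewrite /scaleq /= !mul1r. Qed.

Fact scaleqDr : right_distributive scaleq +%R.
Proof. by move=> a [? ? ? ?] [? ? ? ?]; congr Quat; rewrite /= mulrDr. Qed.

Fact scaleqDl p : {morph scaleq^~ p : a b / a + b}.
Proof. by move=> a b; congr Quat; rewrite /= mulrDl. Qed.

HB.instance Definition _ := GRing.Zmodule_isLmodule.Build R (quat R)
  scaleqA scale1q scaleqDr scaleqDl.

Fact scaleqAl (a : R) p q : a *: (p * q) = (a *: p) * q.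
Proof. by case: p q => ? ? ? ? [? ? ? ?]; congr Quat => /=; ring. Qed.

HB.instance Definition _ := GRing.Lmodule_isLalgebra.Build R (quat R) scaleqAl.

Fact scaleqAr (a : R) p q : a *: (p * q) = p * (a *: q).
Proof. by case: p q => ? ? ? ? [? ? ? ?]; congr Quat => /=; ring. Qed.

HB.instance Definition _ := GRing.Lalgebra_isAlgebra.Build R (quat R) scaleqAr.

End QuatAlgebra.

Section QuaternionFourier.
Context {R : realType}.
Implicit Types (mu nu : quat R) (f g : R * R -> quat R) (x y : R * R).

Definition lebesgue2 : set (measurableTypeR R * measurableTypeR R) -> \bar R :=
  (@lebesgue_measure R \x @lebesgue_measure R)%E.

HB.instance Definition _ := Measure.on lebesgue2.

(* Components are Borel measurable: every class in L^1(R^2) has such a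
   representative, and all notions below only depend on the class. *)
Definition qintegrable f : Prop :=
  [/\ lebesgue2.-integrable setT (fun x => (qre (f x))%:E),
      lebesgue2.-integrable setT (fun x => (qi (f x))%:E),
      lebesgue2.-integrable setT (fun x => (qj (f x))%:E) &
      lebesgue2.-integrable setT (fun x => (qk (f x))%:E)].

Definition qintegral f : quat R :=
  Quat (\int[lebesgue2]_(x in setT) qre (f x))
       (\int[lebesgue2]_(x in setT) qi (f x))
       (\int[lebesgue2]_(x in setT) qj (f x))
       (\int[lebesgue2]_(x in setT) qk (f x)).

(* The reflection f^(phi1, phi2); only the parity of each exponent matters. *)
Definition reflect2 (phi1 phi2 : nat) f : R * R -> quat R :=
  fun x => f ((-1) ^+ phi1 * x.1, (-1) ^+ phi2 * x.2).

Definition qexp mu (t : R) : quat R := (cos t)%:A + sin t *: mu.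

Definition qft mu nu f : R * R -> quat R := fun y =>
  (2 * pi)^-1 *: qintegral (fun x =>
    qexp mu (- (x.1 * y.1)) * qexp nu (- (x.2 * y.2)) * f x).

Definition qconv f g : R * R -> quat R := fun x =>
  qintegral (fun y => f y * g (x.1 - y.1, x.2 - y.2)).

(* The Mustard convolution 2 pi F^-1 (F f * F g): an integrable function whose
   transform is 2 pi F f * F g.  Such a function is determined up to a null
   set and [xget] chooses one; the default 0 would be returned only if there
   were none. *)
Definition mustard mu nu f g : R * R -> quat R :=
  xget (fun=> 0) [set h | qintegrable h /\
    forall y, qft mu nu h y = (2 * pi) *: (qft mu nu f y * qft mu nu g y)].

End QuaternionFourier.

(* Main.v *)
From HB Require Import structures.
Require Import Defs.
From mathcomp Require Import all_boot all_order all_algebra ring lra.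
From mathcomp Require Import all_classical all_reals all_analysis.
From mathcomp Require Import measurable_realfun.

Import Order.TTheory GRing.Theory Num.Theory.
Import numFieldNormedType.Exports.
Local Open Scope classical_set_scope.
Local Open Scope ring_scope.

(* Expanding the exponentials writes 2 pi F(f)(y) as a - nu b - mu c + mu nu d,
   where a, b, c, d are the integrals of f against the products of a cosine or
   sine of x_1 y_1 with a cosine or sine of x_2 y_2.  By Fubini and the addition
   formulas these moments of a classical convolution are bilinear in the moments
   of the factors, and reflections only change their signs.  Hence both sides of
   the claimed formula, and the functions witnessing the existence of Mustard
   convolutions, have transforms that agree by a computation in the
   noncommutative algebra generated by mu, nu and the moments.  It remains to
   see that an integrable function with vanishing moments is null a.e.: it is
   orthogonal to all plane waves cos (s x_1 + t x_2 + b), hence to every bounded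
   pointwise limit of their linear combinations.  Such limits form an algebra
   that contains sgn (sin ((s x_1 + t x_2 - c) / n)), so the indicators of
   half-planes and then of all Borel sets. *)

(** * Bounded pointwise closure of an algebra of functions *)

Section BoundedPointwiseClosure.
Set Implicit Arguments.
Unset Strict Implicit.
Context {R : realType} {T : Type} (G : set (T -> R)).

(** The uniform bound in [bpcl_lim] makes dominated convergence applicable to the limit. Limits may
    be nested to any depth, as the passage to Borel sets requires. *)
Inductive bpcl : (T -> R) -> Prop :=
| bpcl_gen f : G f -> bpcl f
| bpclD f g : bpcl f -> bpcl g -> bpcl (fun x => f x + g x)
| bpclZ a f : bpcl f -> bpcl (fun x => a * f x)
| bpcl_lim (f : nat -> T -> R) g M :
    (forall n, bpcl (f n)) -> (forall n x, `|f n x| <= M) ->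
    (forall x, f n x @[n --> \oo] --> g x) -> bpcl g.

Hypothesis G_bounded : forall f, G f -> exists M, forall x, `|f x| <= M.
Hypothesis G_mul : forall f g, G f -> G g -> bpcl (fun x => f x * g x).
Hypothesis G1 : bpcl (fun=> 1).

Lemma cvg_norm_le (u : nat -> R) (l M : R) :
  u n @[n --> \oo] --> l -> (forall n, `|u n| <= M) -> `|l| <= M.
Proof.
move=> ul uM; rewrite -(cvg_lim _ (cvg_norm ul))//.
apply: limr_le; first by apply/cvg_ex; exists `|l|; exact: cvg_norm.
exact: nearW.
Qed.

Lemma bpcl_bounded f : bpcl f -> exists M, forall x, `|f x| <= M.
Proof.
elim=> {f} [f /G_bounded//|f g _ [M fM] _ [N gN]|a f _ [M fM]|f g M _ _ fM fg].
- by exists (M + N) => x; rewrite (le_trans (ler_normD _ _))// lerD.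
- by exists (`|a| * M) => x; rewrite normrM ler_wpM2l.
- by exists M => x; apply: cvg_norm_le (fg x) _ => n; exact: fM.
Qed.

(** Induction on [f] and, when [f] is a generator, an inner induction on [g]. In the limit cases the
    products stay uniformly bounded because the fixed factor is bounded. *)
Lemma bpclM f g : bpcl f -> bpcl g -> bpcl (fun x => f x * g x).
Proof.
move=> + bg; elim=> {f} [f Gf|f h _ bf _ bh|a f _ bf|f h M bf bfg fM fh].
- elim: bg => {g} [g Gg|g h _ bg _ bh|a g _ bg|g h M _ bg gM gh].
  + exact: G_mul.
  + rewrite (_ : (fun _ => _) = fun x => f x * g x + f x * h x).
      exact: bpclD.
    by apply/funext => x; rewrite mulrDr.
  + rewrite (_ : (fun _ => _) = fun x => a * (f x * g x)).
      exact: bpclZ.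
    by apply/funext => x; rewrite mulrCA.
  + have [N fN] := G_bounded Gf.
    apply: (@bpcl_lim (fun n x => f x * g n x) _ (N * M)) => //.
      by move=> n x; rewrite normrM ler_pM.
    by move=> x; apply: cvgM => //; exact: cvg_cst.
- rewrite (_ : (fun _ => _) = fun x => f x * g x + h x * g x).
    exact: bpclD.
  by apply/funext => x; rewrite mulrDl.
- rewrite (_ : (fun _ => _) = fun x => a * (f x * g x)).
    exact: bpclZ.
  by apply/funext => x; rewrite mulrA.
- have [N gN] := bpcl_bounded bg.
  apply: (@bpcl_lim (fun n x => f n x * g x) _ (M * N)) => //.
    by move=> n x; rewrite normrM ler_pM.
  by move=> x; apply: cvgM => //; exact: cvg_cst.
Qed.

Lemma bpclB f g : bpcl f -> bpcl g -> bpcl (fun x => f x - g x).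
Proof.
move=> bf bg; rewrite (_ : (fun _ => _) = fun x => f x + (-1) * g x).
  by apply: bpclD => //; exact: bpclZ.
by apply/funext => x; rewrite mulN1r.
Qed.

(* Its iterates on [-1, 1] are polynomials converging to the sign function. *)
Definition sgn_step (s : R) : R := (3 * s - s ^+ 3) / 2.

Lemma sgn_stepN s : sgn_step (- s) = - sgn_step s.
Proof. by rewrite /sgn_step; ring. Qed.

Lemma iter_sgn_stepN n s : iter n sgn_step (- s) = - iter n sgn_step s.
Proof. by elim: n => //= n ->; rewrite sgn_stepN. Qed.

(** One step multiplies the defect 1 - t by (2 - t - t^2) / 2, which lies between 0 and 1 - s / 2 as
    long as s <= t <= 1. The iterates therefore increase to 1 at a geometric rate depending on
    [s]. *)
Lemma iter_sgn_step_bnd s n : 0 < s <= 1 ->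
  s <= iter n sgn_step s <= 1 /\
  1 - iter n sgn_step s <= (1 - s / 2) ^+ n.
Proof.
move=> /andP[s0 s1]; elim: n => [|n [/andP[]]].
  by rewrite /= lexx s1 expr0; split=> //; lra.
rewrite iterS; set t := iter n _ s => st t1 tn.
have E : 1 - sgn_step t = (1 - t) * ((2 - t - t ^+ 2) / 2).
  by rewrite /sgn_step; field.
have F : 0 <= (2 - t - t ^+ 2) / 2 <= 1 - s / 2.
  by rewrite expr2; apply/andP; split; nra.
move: F => /andP[F0 F1].
have D : 1 - sgn_step t <= 1 - t by rewrite E; nra.
have D0 : 0 <= 1 - sgn_step t by rewrite E mulr_ge0//; lra.
split; first by apply/andP; split; lra.
by rewrite E (exprSr _ n) ler_pM//; lra.
Qed.

Lemma iter_sgn_step_cvg s : `|s| <= 1 ->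
  iter n sgn_step s @[n --> \oo] --> Num.sg s.
Proof.
have pos t : 0 < t <= 1 -> iter n sgn_step t @[n --> \oo] --> (1 : R).
  move=> t01.
  have /andP[t0 t1] := t01.
  apply: (@squeeze_cvgr _ _ _ _ (fun n => 1 - (1 - t / 2) ^+ n) (fun=> 1)).
  - apply: nearW => n; have [/andP[_ ->] ?] := iter_sgn_step_bnd n t01.
    by rewrite andbT; lra.
  - rewrite -[X in _ --> X]subr0; apply: cvgB; first exact: cvg_cst.
    by apply: cvg_expr; rewrite ger0_norm; lra.
  - exact: cvg_cst.
rewrite ler_norml => /andP[s1 s2].
have [s0|s0|<-] := ltgtP 0 s.
- by rewrite gtr0_sg//; apply: pos; rewrite s0.
- rewrite ltr0_sg//.
  rewrite (_ : (fun n => _) = fun n => - iter n sgn_step (- s)).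
    by apply: cvgN; apply: pos; lra.
  by apply/funext => n; rewrite iter_sgn_stepN opprK.
- rewrite sgr0 (_ : (fun n => _) = fun=> 0); first exact: cvg_cst.
  apply/funext; elim=> //= n ->.
  by rewrite /sgn_step mulr0 expr0n subr0 mul0r.
Qed.

Lemma iter_sgn_step_le1 s n : `|s| <= 1 -> `|iter n sgn_step s| <= 1.
Proof.
have pos t : 0 < t <= 1 -> `|iter n sgn_step t| <= 1.
  move=> t01; have [/andP[t1 ?] _] := iter_sgn_step_bnd n t01.
  by rewrite ger0_norm//; lra.
rewrite ler_norml => /andP[s1 s2].
have [s0|s0|<-] := ltgtP 0 s.
- by apply: pos; rewrite s0.
- by rewrite -(opprK s) iter_sgn_stepN normrN; apply: pos; lra.
- suff -> : iter n sgn_step 0 = 0 by rewrite normr0.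
  by elim: n {pos} => //= n ->; rewrite /sgn_step mulr0 expr0n subr0 mul0r.
Qed.

Lemma bpcl_sg f : bpcl f -> (forall x, `|f x| <= 1) ->
  bpcl (fun x => Num.sg (f x)).
Proof.
move=> bf f1; apply: (@bpcl_lim (fun n x => iter n sgn_step (f x)) _ 1).
- elim=> [//|n bn] /=.
  rewrite (_ : (fun _ => _) = fun x => 3 / 2 * iter n sgn_step (f x) -
    1 / 2 * (iter n sgn_step (f x) *
             (iter n sgn_step (f x) * iter n sgn_step (f x)))).
    by apply: bpclB; apply: bpclZ => //; apply: bpclM => //; exact: bpclM.
  by apply/funext => x; rewrite /sgn_step; field.
- by move=> n x; exact: iter_sgn_step_le1.
- by move=> x; exact: iter_sgn_step_cvg.
Qed.

(** Complements are differences from 1, intersections are products, and countable unions are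
    pointwise limits of finite ones, all with indicators bounded by 1. *)
Lemma bpcl_sigma_algebra : sigma_algebra setT [set A | bpcl \1_A].
Proof.
have bC A : bpcl \1_A -> bpcl (\1_(~` A) : T -> R).
  move=> bA; rewrite (_ : \1_(~` A) = fun x => 1 - \1_A x); first exact: bpclB.
  apply/funext => x; rewrite !indicE in_setC.
  by case: (x \in A) => /=; rewrite ?subrr ?subr0.
have bI A B : bpcl \1_A -> bpcl \1_B -> bpcl (\1_(A `&` B) : T -> R).
  move=> bA bB; rewrite indicI; exact: bpclM.
have b0 : bpcl (\1_set0 : T -> R).
  rewrite (_ : \1_set0 = fun x => 1 - 1); first exact: bpclB.
  by apply/funext => x; rewrite indicE in_set0 subrr.
split=> //= [A bA|F bF]; first by rewrite setTD; exact: bC.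
apply: (@bpcl_lim (fun n => \1_(\big[setU/set0]_(i < n) F i)) _ 1).
- elim=> [|n bn]; first by rewrite big_ord0.
  rewrite big_ord_recr /=.
  rewrite -[_ `|` _]setCK setCU; apply: (bC); apply: bI; exact: bC.
- move=> n x; rewrite indicE.
  by case: (_ \in _); rewrite /= ?normr1 ?normr0 ?ler01.
- move=> x; rewrite indicE; case: (boolP (x \in _)) => [|xF].
    rewrite inE => -[k _ Fkx]; apply: cvg_near_cst; near=> n.
    rewrite indicE mem_set// -bigcup_mkord; exists k => //=.
    by near: n; exists k.+1.
  apply: cvg_near_cst; near=> n; rewrite indicE memNset// => xn.
  move/negP : xF; apply; rewrite inE; move: xn.
  by rewrite -bigcup_mkord => -[k _ Fk]; exists k.
Unshelve. all: by end_near. Qed.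

End BoundedPointwiseClosure.

(** * Functions orthogonal to all plane waves *)

Section BoundedMultiplier.
Set Implicit Arguments.
Unset Strict Implicit.
Context d {T : measurableType d} {R : realType}.
Variable mu : {measure set T -> \bar R}.
Implicit Types (u phi : T -> R).

Lemma integrable_bndM u phi M : mu.-integrable setT (EFin \o u) ->
  measurable_fun setT phi -> (forall x, `|phi x| <= M) ->
  mu.-integrable setT (EFin \o (fun x => phi x * u x)).
Proof.
move=> iu mphi phiM.
rewrite (_ : EFin \o _ = ((EFin \o phi) \* (EFin \o u))%E)//.
apply: integrableMr => //.
by exists M; split=> [|N MN x _]; [exact: num_real|exact: le_trans (ltW MN)].
Qed.

(** Dominated convergence with majorant M |u|. It carries orthogonality to [u] over to bounded
    pointwise limits. *)
Lemma bounded_cvg_Rintegral u (phi : nat -> T -> R) (psi : T -> R) M :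
  mu.-integrable setT (EFin \o u) ->
  (forall n, measurable_fun setT (phi n)) ->
  (forall n x, `|phi n x| <= M) -> (forall x, phi n x @[n --> \oo] --> psi x) ->
  \int[mu]_x (phi n x * u x) @[n --> \oo] --> \int[mu]_x (psi x * u x).
Proof.
move=> iu mphi phiM phipsi.
have mpsi : measurable_fun setT psi.
  by apply: (measurable_fun_cvg (h := phi)) => // x _; exact: phipsi.
have psiM x : `|psi x| <= M by exact: cvg_norm_le (phipsi x) _.
apply: fine_cvg; rewrite fineK; last first.
  apply: integrable_fin_num => //.
  exact: (integrable_bndM iu mpsi psiM).
have mu_ : measurable_fun setT u.
  by apply/measurable_EFinP; case/integrableP: iu.
apply: (@dominated_cvg _ _ _ mu setT _ _ _ (fun x => (M * `|u x|)%:E)) => //.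
- by move=> n; apply/measurable_EFinP; exact: measurable_funM.
- move=> x _; apply: cvg_EFin;
    [exact: nearW|apply: cvgM => //; exact: cvg_cst].
- have := integrableZl measurableT M (integrable_norm iu).
  by apply: eq_integrable => // x _ /=; rewrite EFinM.
- by move=> n x _; rewrite /= lee_fin normrM ler_wpM2r.
Qed.

End BoundedMultiplier.

Section TrigonometricUniqueness.
Set Implicit Arguments.
Unset Strict Implicit.
Context {R : realType}.
Local Notation T2 := (measurableTypeR R * measurableTypeR R)%type.
Local Notation mu := (@lebesgue2 R).
Implicit Types (u phi : T2 -> R).

(** The phase [b] makes sines plane waves too, so that one family suffices. *)
Definition plane_wave (s t b : R) (x : T2) : R := cos (s * x.1 + t * x.2 + b).

Let waves : set (T2 -> R) :=
  [set phi | exists s t b, phi = plane_wave s t b].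

Lemma measurable_plane_wave s t b : measurable_fun setT (plane_wave s t b).
Proof.
apply: measurableT_comp => /=.
  by apply: continuous_measurable_fun; exact: continuous_cos.
by apply: measurable_funD => //; apply: measurable_funD => //;
  apply: measurable_funM.
Qed.

Lemma plane_wave_le1 s t b x : `|plane_wave s t b x| <= 1.
Proof. exact: cos_max. Qed.

Let waves_bounded phi : waves phi -> exists M, forall x, `|phi x| <= M.
Proof. by move=> [s [t [b ->]]]; exists 1 => x; exact: plane_wave_le1. Qed.

Let wave_in s t b : bpcl waves (plane_wave s t b).
Proof. by apply: bpcl_gen; exists s, t, b. Qed.

(** Product-to-sum formula: cos A cos B is half the sum of cos (A + B) and cos (A - B). *)
Let wavesM phi psi : waves phi -> waves psi ->
  bpcl waves (fun x => phi x * psi x).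
Proof.
move=> [s [t [b ->]]] [s' [t' [b' ->]]].
rewrite (_ : (fun _ => _) = fun x =>
    2^-1 * plane_wave (s + s') (t + t') (b + b') x +
    2^-1 * plane_wave (s - s') (t - t') (b - b') x).
  by apply: bpclD; apply: bpclZ; exact: wave_in.
apply/funext => x; rewrite /plane_wave.
set A := s * _ + _ + b; set B := s' * _ + _ + b'.
rewrite (_ : (s + s') * _ + _ + _ = A + B); last by rewrite /A /B; ring.
rewrite (_ : (s - s') * _ + _ + _ = A - B); last by rewrite /A /B; ring.
by move: A B => A B; rewrite !cosD cosN sinN; field.
Qed.

Let wave1 : bpcl waves (fun=> 1).
Proof.
rewrite (_ : (fun=> 1) = plane_wave 0 0 0); first exact: wave_in.
by apply/funext => x; rewrite /plane_wave !mul0r !addr0 cos0.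
Qed.

(* sgn (sin (a / n)) = sgn a as soon as |a| < n * pi. *)
Lemma sg_sin_cvg (a : R) :
  Num.sg (sin (n.+1%:R^-1 * a)) @[n --> \oo] --> Num.sg a.
Proof.
apply: cvg_near_cst.
have main (c : R) : 0 < c -> \forall n \near \oo, 0 < sin (n.+1%:R^-1 * c).
  move=> c0; near=> n; apply: sin_gt0_pi.
  rewrite mulr_gt0 ?invr_gt0//= mulrC ltr_pdivrMr//.
  have : c < n%:R by near: n; exact: nbhs_infty_gtr.
  have := @pi_ge2 R; rewrite -natr1 => p2 cn.
  by rewrite (lt_le_trans cn)//; nra.
have [a0|a0|<-] := ltgtP 0 a; last by near=> n; rewrite mulr0 sin0.
- near=> n; rewrite !gtr0_sg//; near: n; exact: main.
- near=> n; rewrite !ltr0_sg// -oppr_gt0 -sinN -mulrN; near: n.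
  by apply: main; rewrite oppr_gt0.
Unshelve. all: by end_near. Qed.

(** The sign e of s x_1 + t x_2 - c is a limit of signs of sines, and (e^2 + e) / 2 is 1 for e = 1
    and 0 for e = 0 or e = -1. *)
Let bpcl_halfplane s t c :
  bpcl waves \1_[set x : T2 | c < s * x.1 + t * x.2].
Proof.
have bs : bpcl waves (fun x => Num.sg (s * x.1 + t * x.2 - c)).
  apply: (@bpcl_lim _ _ _ (fun n x =>
    Num.sg (sin (n.+1%:R^-1 * (s * x.1 + t * x.2 - c)))) _ 1).
  - move=> n; apply: bpcl_sg => //; last by move=> x; exact: sin_max.
    (* The sine of an angle z is written as the plane wave cos (pi / 2 - z). *)
    rewrite (_ : (fun _ => _) =
      plane_wave (- (n.+1%:R^-1 * s)) (- (n.+1%:R^-1 * t))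
        (n.+1%:R^-1 * c + pi / 2)).
      exact: wave_in.
    apply/funext => x; rewrite -[LHS]opprK -sinN -cosDpihalf /plane_wave.
    by congr cos; ring.
  - by move=> n x; rewrite normr_sg; case: (_ == _); rewrite /= ?ler01.
  - by move=> x; exact: sg_sin_cvg.
rewrite (_ : \1_ _ = fun x => 2^-1 *
  (Num.sg (s * x.1 + t * x.2 - c) * Num.sg (s * x.1 + t * x.2 - c) +
   Num.sg (s * x.1 + t * x.2 - c))).
  by apply: bpclZ; apply: bpclD => //; exact: bpclM.
apply/funext => x; rewrite indicE.
have [xc|cx] := leP (s * x.1 + t * x.2) c.
  rewrite memNset /=; last by apply/negP; rewrite -leNgt.
  move: xc; rewrite le_eqVlt => /predU1P[->|xc].
    by rewrite subrr sgr0 mulr0 addr0 mulr0.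
  by rewrite ltr0_sg ?subr_lt0// mulrNN mulr1 subrr mulr0.
by rewrite mem_set//= gtr0_sg ?subr_gt0// mulr1 mulVf.
Qed.

(** Preimages of Borel sets under the two coordinates generate the product sigma-algebra, and open
    rays generate the Borel sets of the line; the preimage of a ray under a coordinate is a
    half-plane. *)
Let bpcl_indic (A : set T2) : measurable A -> bpcl waves \1_A.
Proof.
have [S0 SC SU] := bpcl_sigma_algebra waves_bounded wavesM wave1.
have half (p : T2 -> measurableTypeR R) s t :
    (forall x, p x = s * x.1 + t * x.2) ->
    forall B, measurable B -> bpcl waves \1_(p @^-1` B).
  move=> pE B mB; have {mB} : (@RGenOInfty.G R).-sigma.-measurable B.
    by rewrite -RGenOInfty.measurableE.
  suff : (@RGenOInfty.G R).-sigma.-measurable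
      `<=` [set B | bpcl waves \1_(p @^-1` B)] by apply.
  apply: smallest_sub.
    split=> [|C /=|F /=]; first by rewrite /= preimage_set0; exact: S0.
      by move/SC; rewrite setTD setTD preimage_setC.
    by move=> /SU; rewrite preimage_bigcup.
  move=> _ [c ->] /=.
  rewrite (_ : _ @^-1` _ = [set x | c < s * x.1 + t * x.2]).
    exact: bpcl_halfplane.
  by apply/seteqP; split => x /=; rewrite in_itv/= andbT pE.
move: A; suff : measurable `<=` [set A : set T2 | bpcl waves \1_A] by apply.
apply: smallest_sub; first by split.
by move=> _ [] [B mB <-] /=; rewrite setTI;
  [apply: (half _ 1 0)|apply: (half _ 0 1)] => // x;
  rewrite mul1r mul0r ?addr0 ?add0r.
Qed.

Lemma plane_wave_uniqueness u : mu.-integrable setT (EFin \o u) ->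
  (forall s t b, \int[mu]_x (plane_wave s t b x * u x) = 0) ->
  {ae mu, forall x, u x = 0}.
Proof.
move=> iu u0.
(* Measurability and boundedness are carried through the induction because linearity of the integral
   and dominated convergence rely on them. *)
have bpcl0 phi : bpcl waves phi -> 
  [/\ measurable_fun setT phi, exists M, forall x, `|phi x| <= M &
      \int[mu]_x (phi x * u x) = 0].
  elim=> {phi} [_ [s [t [b ->]]]|f g _ [mf [M fM] f0] _ [mg [N gN] g0]
    |a f _ [mf [M fM] f0]|f g M _ IH fM fg].
  - split; [exact: measurable_plane_wave| |exact: u0].
    by exists 1 => x; exact: plane_wave_le1.
  - split; first exact: measurable_funD.
      by exists (M + N) => x; rewrite (le_trans (ler_normD _ _))// lerD.
    under eq_Rintegral do rewrite mulrDl.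
    by rewrite RintegralD ?f0 ?g0 ?addr0//; exact: integrable_bndM.
  - split; first exact: measurable_funM.
      by exists (`|a| * M) => x; rewrite normrM ler_wpM2l.
    under eq_Rintegral do rewrite -mulrA.
    by rewrite RintegralZl ?f0 ?mulr0//; exact: integrable_bndM.
  - have mf n : measurable_fun setT (f n) by have [] := IH n.
    split.
    + by apply: (measurable_fun_cvg (h := f)) => // x _; exact: fg.
    + by exists M => x; exact: (cvg_norm_le (fg x)).
    + have := bounded_cvg_Rintegral iu mf fM fg.
      rewrite (_ : (fun n => _) = fun=> 0); last first.
        by apply/funext => n; have [] := IH n.
      by move/(cvg_lim (@Rhausdorff R)) => <-; exact: lim_cst.
(* With indicators as multipliers, [u] has integral zero over every measurable set, which forces it
   to vanish a.e. *)
suff : ae_eq mu setT (EFin \o u) (cst 0%E).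
  by apply: filterS => x /= /(_ I) [].
apply: integral_ae_eq => // E _ mE.
rewrite integral_cst// mul0e.
have [_ _] := bpcl0 _ (bpcl_indic mE).
rewrite (_ : (fun x => _) = u \_ E).
  rewrite -Rintegral_mkcond => h.
  rewrite -[LHS]fineK//.
    by rewrite -[X in X%:E]/(Rintegral _ _ _) h.
  by apply: integrable_fin_num => //; exact: integrableS iu.
apply/funext => x; rewrite patchE indicE.
by case: (x \in E); rewrite ?mul1r ?mul0r.
Qed.

End TrigonometricUniqueness.

(** * Invariance of Lebesgue measure and real convolution *)

Section MeasurePreserving.
Set Implicit Arguments.
Unset Strict Implicit.
Context d {T : measurableType d} {R : realType}.
Variable mu : {measure set T -> \bar R}.

Definition measure_preserving (phi : T -> T) : Prop :=
  measurable_fun setT phi /\ forall A, measurable A -> mu (phi @^-1` A) = mu A.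

Variables (phi : T -> T) (phiP : measure_preserving phi).

(** The pushforward of [mu] along [phi] is [mu] itself, so this is the change of variables formula
    for a pushforward. *)
Lemma ge0_integral_preserving (f : T -> \bar R) : measurable_fun setT f ->
  (forall x, 0 <= f x)%E ->
  (\int[mu]_x f (phi x) = \int[mu]_x f x)%E.
Proof.
have [mphi phiE] := phiP; move=> mf f0.
have := ge0_integral_pushforward mphi mu measurableT mf (fun y _ => f0 y).
rewrite preimage_setT => <-; apply: eq_measure_integral => A mA _.
exact: phiE.
Qed.

Lemma integrable_preserving (u : T -> R) : mu.-integrable setT (EFin \o u) ->
  mu.-integrable setT (EFin \o (u \o phi)).
Proof.
have [mphi phiE] := phiP; move=> iu; have /integrableP[mu_ uoo] := iu.
apply/integrableP; split; first exact: (measurableT_comp mu_ mphi).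
rewrite (ge0_integral_preserving (f := fun x => `|(u x)%:E|%E))//.
exact: measurableT_comp.
Qed.

Lemma Rintegral_preserving (u : T -> R) : mu.-integrable setT (EFin \o u) ->
  \int[mu]_x u (phi x) = \int[mu]_x u x.
Proof.
have [mphi phiE] := phiP; move=> iu; congr fine.
have mu_ := measurable_int _ iu.
have := integral_pushforward mphi mu_ (integrable_preserving iu) measurableT.
rewrite preimage_setT => <-; apply: eq_measure_integral => A mA _.
exact: phiE.
Qed.

End MeasurePreserving.

(** Squares of an increasing exhaustion of the line: monotonicity puts both coordinates of a point
    into a common member. Fubini on the product of two planes relies on this. *)
Fact lebesgue2_sigma_finite (R : realType) : sigma_finite setT (@lebesgue2 R).
Proof.
have /sigma_finiteP[F [FT ndF Foo]] := sigma_finiteT (@lebesgue_measure R).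
exists (fun n => F n `*` F n) => [|n].
  apply/seteqP; split=> // -[x y] _.
  have [m _ Fx] : (\bigcup_k F k) x by rewrite -FT.
  have [n _ Fy] : (\bigcup_k F k) y by rewrite -FT.
  exists (maxn m n) => //; split => /=.
    by move: x Fx; exact/subsetPset/ndF/leq_maxl.
  by move: y Fy; exact/subsetPset/ndF/leq_maxr.
have [mF Fn] := Foo n; split; first exact: measurableX.
by rewrite /lebesgue2 product_measure1E// lte_mul_pinfty// ge0_fin_numE.
Qed.

HB.instance Definition _ (R : realType) :=
  Measure_isSigmaFinite.Build _ _ _ (@lebesgue2 R) (lebesgue2_sigma_finite R).

(** * Translations and reflections of the plane *)

Section PlaneMotions.
Set Implicit Arguments.
Unset Strict Implicit.
Context {R : realType}.
Local Notation T1 := (measurableTypeR R).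
Local Notation T2 := (measurableTypeR R * measurableTypeR R)%type.

(** Lebesgue measure is determined by its values on half-open intervals, and translation keeps their
    lengths. *)
Lemma lebesgue_preservingD (a : R) :
  measure_preserving (@lebesgue_measure R) (fun x : T1 => x + a : T1).
Proof.
have m : measurable_fun setT (fun x : T1 => x + a : T1).
  exact: measurable_funD.
split=> // A mA; apply/esym.
rewrite -[RHS]/(pushforward (@lebesgue_measure R) (fun x : T1 => x + a : T1) A).
apply: lebesgue_measure_unique => //= _ [[b c]] _ <-.
rewrite /pushforward (_ : _ @^-1` _ = `]b - a, c - a]%classic).
  rewrite !lebesgue_measure_itv/= !lte_fin ltrD2r -!EFinB.
  by rewrite opprB addrA subrK.
by apply/seteqP; split => x /=; rewrite !in_itv/= ltrBlDr lerBrDr.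
Qed.

Lemma lebesgue_preservingN :
  measure_preserving (@lebesgue_measure R) (fun x : T1 => - x : T1).
Proof.
split=> [|A mA]; last by rewrite -[RHS](lebesgue_measureN mA).
exact: measurable_funN.
Qed.

Lemma lebesgue_preserving_sign n :
  measure_preserving (@lebesgue_measure R) (fun x : T1 => (-1) ^+ n * x : T1).
Proof.
rewrite -signr_odd; case: (odd n); rewrite ?expr1 ?expr0.
  rewrite (_ : (fun _ => _) = fun x => - x); first exact: lebesgue_preservingN.
  by apply/funext => x; rewrite mulN1r.
rewrite (_ : (fun _ => _) = fun x => x).
  by split=> //; exact: measurable_id.
by apply/funext => x; rewrite mul1r.
Qed.

(** A product measure is determined by its values on rectangles, and the preimage of a rectangle is
    again a rectangle. *)
Lemma lebesgue2_preserving (p q : T1 -> T1) :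
  measure_preserving (@lebesgue_measure R) p ->
  measure_preserving (@lebesgue_measure R) q ->
  measure_preserving (@lebesgue2 R) (fun x : T2 => (p x.1, q x.2)).
Proof.
move=> [mp pE] [mq qE].
have m : measurable_fun setT (fun x : T2 => (p x.1, q x.2)).
  by apply: measurable_fun_pair; exact: measurableT_comp.
split=> // A mA; apply/esym.
rewrite -[RHS]/(pushforward (@lebesgue2 R) (fun x : T2 => (p x.1, q x.2)) A).
apply: product_measure_unique => // B C mB mC /=.
rewrite /pushforward (_ : _ @^-1` _ = (p @^-1` B) `*` (q @^-1` C))//.
rewrite /lebesgue2 product_measure1E ?pE ?qE//=.
  by rewrite -[X in measurable X]setTI; exact: mp.
by rewrite -[X in measurable X]setTI; exact: mq.
Qed.

Lemma lebesgue2_preserving_reflect (m n : nat) :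
  measure_preserving (@lebesgue2 R)
    (fun x : T2 => ((-1) ^+ m * x.1, (-1) ^+ n * x.2)).
Proof. by apply: lebesgue2_preserving; exact: lebesgue_preserving_sign. Qed.

Lemma lebesgue2_preservingD (a b : R) :
  measure_preserving (@lebesgue2 R) (fun x : T2 => (x.1 + a, x.2 + b)).
Proof.
exact: (lebesgue2_preserving (lebesgue_preservingD a) (lebesgue_preservingD b)).
Qed.

End PlaneMotions.

(** * Convolution of integrable real functions on the plane *)

Section RealConvolution.
Set Implicit Arguments.
Unset Strict Implicit.
Context {R : realType}.
Local Notation T2 := (measurableTypeR R * measurableTypeR R)%type.
Local Notation mu := (@lebesgue2 R).
Implicit Types (u v phi : T2 -> R).

Definition rconv u v : T2 -> R :=
  fun x => \int[mu]_y (u y * v (x.1 - y.1, x.2 - y.2)).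

(** The integrand of [rconv] on the product of two planes: [z.1] is the point of evaluation, [z.2]
    the variable of integration. *)
Definition rconv_kernel u v (z : T2 * T2) : R :=
  u z.2 * v (z.1.1 - z.2.1, z.1.2 - z.2.2).

Variables (u v : T2 -> R).
Hypothesis iu : mu.-integrable setT (EFin \o u).
Hypothesis iv : mu.-integrable setT (EFin \o v).

Let kern := rconv_kernel u v.

Let measurable_kern : measurable_fun setT kern.
Proof.
have mu_ : measurable_fun setT u by apply/measurable_EFinP; case/integrableP: iu.
have mv : measurable_fun setT v by apply/measurable_EFinP; case/integrableP: iv.
apply: measurable_funM; first exact: measurableT_comp.
apply: (measurableT_comp mv).
apply: measurable_fun_pair; apply: measurable_funB.
- exact: (measurableT_comp measurable_fst measurable_fst).
- exact: (measurableT_comp measurable_fst measurable_snd).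
- exact: (measurableT_comp measurable_snd measurable_fst).
- exact: (measurableT_comp measurable_snd measurable_snd).
Qed.

(** Tonelli, integrating over the point of evaluation first: by translation invariance the inner
    integral is |u(y)| times the L^1 norm of [v]. *)
Lemma integrable_rconv_kernel : (mu \x mu)%E.-integrable setT (EFin \o kern).
Proof.
have /integrableP[mu_ uoo] := iu; have /integrableP[mv voo] := iv.
apply/integrable21ltyP; first exact/measurable_EFinP.
rewrite (_ : (fun y => _) = fun y => (`|(u y)%:E| * \int[mu]_x `|(v x)%:E|)%E).
  rewrite ge0_integralZr//.
  - by rewrite lte_mul_pinfty// ?integral_ge0// ge0_fin_numE// integral_ge0.
  - exact: measurableT_comp.
  - exact: integral_ge0.
apply/funext => y; rewrite /kern /rconv_kernel /=.
have t := lebesgue2_preservingD (- y.1) (- y.2).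
rewrite -(ge0_integral_preserving t (f := fun x => `|(v x)%:E|%E))//; last first.
  exact: measurableT_comp.
rewrite -ge0_integralZl//.
- by apply: eq_integral => x _; rewrite normrM EFinM.
- have [mt _] := t; apply: measurableT_comp => //.
  exact: (measurableT_comp mv mt).
Qed.

Lemma ae_integrable_rconv : {ae mu, forall x : T2, mu.-integrable setT
  (EFin \o (fun y => u y * v (x.1 - y.1, x.2 - y.2)))}.
Proof. exact: (ae_integrable1 integrable_rconv_kernel). Qed.

Lemma integrable_rconv : mu.-integrable setT (EFin \o rconv u v).
Proof.
have /integrableP[mF Foo] := integrable_fubini_F integrable_rconv_kernel.
apply/integrableP; split.
  by apply/measurable_EFinP; exact: (measurableT_comp _ mF).
apply: le_lt_trans Foo; apply: ge0_le_integral => //.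
- apply: measurableT_comp => //.
  by apply/measurable_EFinP; exact: (measurableT_comp _ mF).
- exact: measurableT_comp.
(* Where the inner integral is infinite, [rconv] takes the default value 0, so the bound still
   holds. *)
- move=> x _ /=; rewrite /rconv /Rintegral /fubini_F.
  by case: (\int[_]_(_ in _) _)%E => [r| |]//=; rewrite normr0 leey.
Qed.

(** Fubini, then the substitution x = z + y in the inner integral. The sum in the argument of [phi]
    is what the addition formulas act on. *)
Lemma Rintegral_rconv phi M : measurable_fun setT phi ->
  (forall x, `|phi x| <= M) ->
  \int[mu]_x (phi x * rconv u v x) =
  \int[mu]_y (u y * \int[mu]_z (phi (z.1 + y.1, z.2 + y.2) * v z)).
Proof.
move=> mphi phiM.
have ik : (mu \x mu)%E.-integrable setT
    (EFin \o (fun z : T2 * T2 => phi z.1 * kern z)).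
  apply: (integrable_bndM (M := M) integrable_rconv_kernel) => //.
  exact: measurableT_comp.
have /integrableP[mv _] := iv.
transitivity (fine (\int[mu]_x \int[mu]_y (phi x * kern (x, y))%:E)%E).
  congr fine; apply: ae_eq_integral => //.
  - apply/measurable_EFinP/measurable_funM => //.
    by apply/measurable_EFinP; case/integrableP: integrable_rconv.
  - exact: (measurable_fubini_F ik).
  (* The factor [phi x] moves into the inner integral at those [x] where that integral converges,
     which is almost everywhere. *)
  - apply: filterS ae_integrable_rconv => x ix _.
    under eq_integral do rewrite EFinM.
    rewrite integralZl// EFinM /rconv /Rintegral fineK//.
    exact: integrable_fin_num.
rewrite (Fubini ik); congr fine; apply: eq_integral => y _ /=.
pose w (z : T2) := phi (z.1 + y.1, z.2 + y.2) * v z.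
have iw : mu.-integrable setT (EFin \o w).
  apply: (integrable_bndM (M := M) iv) => //.
  by have [mt _] := lebesgue2_preservingD y.1 y.2; exact: (measurableT_comp mphi mt).
have t := lebesgue2_preservingD (- y.1) (- y.2).
have iwt := integrable_preserving t iw.
transitivity (\int[mu]_x ((u y)%:E * (w (x.1 - y.1, x.2 - y.2))%:E))%E.
  apply: eq_integral => x _; rewrite -EFinM; congr EFin.
  by rewrite /w /kern /rconv_kernel /= !subrK -surjective_pairing mulrCA.
rewrite integralZl// EFinM -(Rintegral_preserving t iw) /Rintegral fineK//.
exact: integrable_fin_num.
Qed.

End RealConvolution.

(** * Linear combinations of four integrable functions *)

Section FourTermCombinations.
Set Implicit Arguments.
Unset Strict Implicit.
Context d {T : measurableType d} {R : realType}.
Variable mu : {measure set T -> \bar R}.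
Variables (u0 u1 u2 u3 : T -> R).
Hypothesis i0 : mu.-integrable setT (EFin \o u0).
Hypothesis i1 : mu.-integrable setT (EFin \o u1).
Hypothesis i2 : mu.-integrable setT (EFin \o u2).
Hypothesis i3 : mu.-integrable setT (EFin \o u3).
Variables (c0 c1 c2 c3 : R).

Let integrable_add (u v : T -> R) : mu.-integrable setT (EFin \o u) ->
  mu.-integrable setT (EFin \o v) ->
  mu.-integrable setT (EFin \o (fun x => u x + v x)).
Proof.
by move=> iu iv; have := integrableD measurableT iu iv; apply: eq_integrable.
Qed.

Let integrable_scale (c : R) (u : T -> R) : mu.-integrable setT (EFin \o u) ->
  mu.-integrable setT (EFin \o (fun x => c * u x)).
Proof.
by move=> iu; have := integrableZl measurableT c iu; apply: eq_integrable.
Qed.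

(** Four terms occur both in the components of a quaternion product and in the addition formula for
    a product of two trigonometric functions. *)
Lemma integrable_comb4 : mu.-integrable setT
  (EFin \o (fun x => c0 * u0 x + c1 * u1 x + c2 * u2 x + c3 * u3 x)).
Proof. by do 3?apply: integrable_add; exact: integrable_scale. Qed.

Lemma Rintegral_comb4 :
  \int[mu]_x (c0 * u0 x + c1 * u1 x + c2 * u2 x + c3 * u3 x) =
  c0 * \int[mu]_x u0 x + c1 * \int[mu]_x u1 x + c2 * \int[mu]_x u2 x +
  c3 * \int[mu]_x u3 x.
Proof.
have j0 := integrable_scale c0 i0; have j1 := integrable_scale c1 i1.
have j2 := integrable_scale c2 i2; have j3 := integrable_scale c3 i3.
have j01 := integrable_add j0 j1; have j012 := integrable_add j01 j2.
by rewrite !RintegralD// !RintegralZl.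
Qed.

End FourTermCombinations.

(** * Moments of convolutions *)

Section ConvolutionMoments.
Set Implicit Arguments.
Unset Strict Implicit.
Context {R : realType}.
Local Notation T2 := (measurableTypeR R * measurableTypeR R)%type.
Local Notation mu := (@lebesgue2 R).

(** The expansion of [phi] separates [y] from [z], so the iterated integral given by
    [Rintegral_rconv] splits into products of single integrals. *)
Lemma Rintegral_rconv_comb4 (u v phi : T2 -> R) (p q : 'I_4 -> T2 -> R)
    (c : 'I_4 -> R) :
  mu.-integrable setT (EFin \o u) -> mu.-integrable setT (EFin \o v) ->
  measurable_fun setT phi -> (forall x, `|phi x| <= 1) ->
  (forall i, measurable_fun setT (p i)) -> (forall i x, `|p i x| <= 1) ->
  (forall i, measurable_fun setT (q i)) -> (forall i x, `|q i x| <= 1) ->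
  (forall y z, phi (z.1 + y.1, z.2 + y.2) =
    c 0 * (p 0 y * q 0 z) + c 1 * (p 1 y * q 1 z) +
    c 2 * (p 2 y * q 2 z) + c 3 * (p 3 y * q 3 z)) ->
  \int[mu]_x (phi x * rconv u v x) =
    c 0 * (\int[mu]_x (p 0 x * u x) * \int[mu]_x (q 0 x * v x)) +
    c 1 * (\int[mu]_x (p 1 x * u x) * \int[mu]_x (q 1 x * v x)) +
    c 2 * (\int[mu]_x (p 2 x * u x) * \int[mu]_x (q 2 x * v x)) +
    c 3 * (\int[mu]_x (p 3 x * u x) * \int[mu]_x (q 3 x * v x)).
Proof.
move=> iu iv mphi phi1 mp p1 mq q1 phiE.
have ipu i : mu.-integrable setT (EFin \o (fun x => p i x * u x)).
  exact: integrable_bndM iu (mp i) (p1 i).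
have iqv i : mu.-integrable setT (EFin \o (fun x => q i x * v x)).
  exact: integrable_bndM iv (mq i) (q1 i).
rewrite (Rintegral_rconv iu iv mphi phi1).
pose J i := \int[mu]_x (q i x * v x).
transitivity (\int[mu]_y (c 0 * J 0 * (p 0 y * u y) + c 1 * J 1 * (p 1 y * u y) +
  c 2 * J 2 * (p 2 y * u y) + c 3 * J 3 * (p 3 y * u y))).
  apply: eq_Rintegral => y _.
  transitivity (u y * \int[mu]_z (c 0 * p 0 y * (q 0 z * v z) +
    c 1 * p 1 y * (q 1 z * v z) + c 2 * p 2 y * (q 2 z * v z) +
    c 3 * p 3 y * (q 3 z * v z))).
    congr (_ * _); apply: eq_Rintegral => z _; rewrite phiE; ring.
  by rewrite Rintegral_comb4// /J; ring.
by rewrite Rintegral_comb4// /J; ring.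
Qed.

Variables (u v : 'I_4 -> T2 -> R) (c : 'I_4 -> R).
Hypothesis iu : forall i, mu.-integrable setT (EFin \o u i).
Hypothesis iv : forall i, mu.-integrable setT (EFin \o v i).

Let K (z : T2 * T2) : R :=
  c 0 * rconv_kernel (u 0) (v 0) z + c 1 * rconv_kernel (u 1) (v 1) z +
  c 2 * rconv_kernel (u 2) (v 2) z + c 3 * rconv_kernel (u 3) (v 3) z.

(** The shape of a component of [qconv]: one integral of a sum, known to equal the combination of
    the four [rconv] only where all four converge. *)
Let F (x : T2) : R := \int[mu]_y K (x, y).

Let iK : (mu \x mu)%E.-integrable setT (EFin \o K).
Proof. by apply: integrable_comb4; exact: integrable_rconv_kernel. Qed.

Lemma integrable_rconv_comb4 : mu.-integrable setT (EFin \o F).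
Proof.
have /integrableP[mF Foo] := integrable_fubini_F iK.
apply/integrableP; split.
  by apply/measurable_EFinP; exact: (measurableT_comp _ mF).
apply: le_lt_trans Foo; apply: ge0_le_integral => //.
- apply: measurableT_comp => //.
  by apply/measurable_EFinP; exact: (measurableT_comp _ mF).
- exact: measurableT_comp.
- move=> x _ /=; rewrite /F /Rintegral /fubini_F.
  by case: (\int[_]_(_ in _) _)%E => [r| |]//=; rewrite normr0 leey.
Qed.

Lemma Rintegral_rconv_comb4r (phi : T2 -> R) :
  measurable_fun setT phi -> (forall x, `|phi x| <= 1) ->
  \int[mu]_x (phi x * F x) =
    c 0 * \int[mu]_x (phi x * rconv (u 0) (v 0) x) +
    c 1 * \int[mu]_x (phi x * rconv (u 1) (v 1) x) +
    c 2 * \int[mu]_x (phi x * rconv (u 2) (v 2) x) +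
    c 3 * \int[mu]_x (phi x * rconv (u 3) (v 3) x).
Proof.
move=> mphi phi1.
have ir i : mu.-integrable setT (EFin \o (fun x => phi x * rconv (u i) (v i) x)).
  exact: integrable_bndM (integrable_rconv (iu i) (iv i)) mphi phi1.
rewrite -Rintegral_comb4//.
have iphiF := integrable_bndM integrable_rconv_comb4 mphi phi1.
congr fine; apply: ae_eq_integral => //.
- exact: (measurable_int _ iphiF).
- exact: (measurable_int _ (integrable_comb4 (ir 0) (ir 1) (ir 2) (ir 3) _ _ _ _)).
(* At almost every point all four convolution integrals converge, and there the integral may be
   split. *)
have h i := ae_integrable_rconv (iu i) (iv i).
apply: filterS2 (filterI (h 0) (h 1)) (filterI (h 2) (h 3)).
move=> x [h0 h1] [h2 h3] _ /=; congr EFin.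
by rewrite /F /K /rconv_kernel /= Rintegral_comb4// /rconv; ring.
Qed.

End ConvolutionMoments.

(** * Integrals of quaternion functions *)

Section QuaternionComponents.
Set Implicit Arguments.
Unset Strict Implicit.
Context {R : realType}.
Implicit Types (p q : quat R) (a : R).

Lemma quatP p q : qre p = qre q -> qi p = qi q -> qj p = qj q ->
  qk p = qk q -> p = q.
Proof. by case: p q => ? ? ? ? [? ? ? ?] /= -> -> -> ->. Qed.

Lemma qreD p q : qre (p + q) = qre p + qre q. Proof. by []. Qed.
Lemma qiD p q : qi (p + q) = qi p + qi q. Proof. by []. Qed.
Lemma qjD p q : qj (p + q) = qj p + qj q. Proof. by []. Qed.
Lemma qkD p q : qk (p + q) = qk p + qk q. Proof. by []. Qed.
Lemma qreN p : qre (- p) = - qre p. Proof. by []. Qed.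
Lemma qiN p : qi (- p) = - qi p. Proof. by []. Qed.
Lemma qjN p : qj (- p) = - qj p. Proof. by []. Qed.
Lemma qkN p : qk (- p) = - qk p. Proof. by []. Qed.
Lemma qreZ a p : qre (a *: p) = a * qre p. Proof. by []. Qed.
Lemma qiZ a p : qi (a *: p) = a * qi p. Proof. by []. Qed.
Lemma qjZ a p : qj (a *: p) = a * qj p. Proof. by []. Qed.
Lemma qkZ a p : qk (a *: p) = a * qk p. Proof. by []. Qed.

Lemma qreM p q :
  qre (p * q) = qre p * qre q - qi p * qi q - qj p * qj q - qk p * qk q.
Proof. by []. Qed.
Lemma qiM p q :
  qi (p * q) = qre p * qi q + qi p * qre q + qj p * qk q - qk p * qj q.
Proof. by []. Qed.
Lemma qjM p q :
  qj (p * q) = qre p * qj q - qi p * qk q + qj p * qre q + qk p * qi q.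
Proof. by []. Qed.
Lemma qkM p q :
  qk (p * q) = qre p * qk q + qi p * qj q - qj p * qi q + qk p * qre q.
Proof. by []. Qed.

Definition quat_linE :=
  (qreD, qiD, qjD, qkD, qreN, qiN, qjN, qkN, qreZ, qiZ, qjZ, qkZ).
Definition quat_mulE := (qreM, qiM, qjM, qkM).

End QuaternionComponents.

Section QuaternionIntegral.
Set Implicit Arguments.
Unset Strict Implicit.
Context {R : realType}.
Local Notation T2 := (measurableTypeR R * measurableTypeR R)%type.
Local Notation mu := (@lebesgue2 R).
Implicit Types (f g : R * R -> quat R) (q : quat R) (a : R).

Let eqi (u v : T2 -> R) : u =1 v -> mu.-integrable setT (EFin \o u) ->
  mu.-integrable setT (EFin \o v).
Proof. by move=> uv; apply: eq_integrable => // x _ /=; rewrite uv. Qed.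

Lemma qintegrableM q f : qintegrable f -> qintegrable (fun x => q * f x).
Proof.
move=> [f0 f1 f2 f3]; split.
- by apply: eqi (integrable_comb4 f0 f1 f2 f3 (qre q) (- qi q) (- qj q) (- qk q)) => x;
  rewrite qreM; ring.
- by apply: eqi (integrable_comb4 f0 f1 f2 f3 (qi q) (qre q) (- qk q) (qj q)) => x;
  rewrite qiM; ring.
- by apply: eqi (integrable_comb4 f0 f1 f2 f3 (qj q) (qk q) (qre q) (- qi q)) => x;
  rewrite qjM; ring.
- by apply: eqi (integrable_comb4 f0 f1 f2 f3 (qk q) (- qj q) (qi q) (qre q)) => x;
  rewrite qkM; ring.
Qed.

Lemma qintegrableMr q f : qintegrable f -> qintegrable (fun x => f x * q).
Proof.
move=> [f0 f1 f2 f3]; split.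
- by apply: eqi (integrable_comb4 f0 f1 f2 f3 (qre q) (- qi q) (- qj q) (- qk q)) => x;
  rewrite qreM; ring.
- by apply: eqi (integrable_comb4 f0 f1 f2 f3 (qi q) (qre q) (qk q) (- qj q)) => x;
  rewrite qiM; ring.
- by apply: eqi (integrable_comb4 f0 f1 f2 f3 (qj q) (- qk q) (qre q) (qi q)) => x;
  rewrite qjM; ring.
- by apply: eqi (integrable_comb4 f0 f1 f2 f3 (qk q) (qj q) (- qi q) (qre q)) => x;
  rewrite qkM; ring.
Qed.

Lemma qintegrableD f g : qintegrable f -> qintegrable g ->
  qintegrable (fun x => f x + g x).
Proof.
move=> [f0 f1 f2 f3] [g0 g1 g2 g3]; split.
- by apply: eqi (integrable_comb4 f0 g0 f0 f0 1 1 0 0) => x; rewrite qreD; ring.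
- by apply: eqi (integrable_comb4 f1 g1 f1 f1 1 1 0 0) => x; rewrite qiD; ring.
- by apply: eqi (integrable_comb4 f2 g2 f2 f2 1 1 0 0) => x; rewrite qjD; ring.
- by apply: eqi (integrable_comb4 f3 g3 f3 f3 1 1 0 0) => x; rewrite qkD; ring.
Qed.

Lemma qintegrableZ a f : qintegrable f -> qintegrable (fun x => a *: f x).
Proof.
move=> /(qintegrableM a%:A); rewrite (_ : (fun x => a%:A * _) = fun x => a *: f x)//.
by apply/funext => x; rewrite -scalerAl mul1r.
Qed.

Lemma qintegrableN f : qintegrable f -> qintegrable (fun x => - f x).
Proof.
move=> /(qintegrableZ (-1)); rewrite (_ : (fun x => _ *: _) = fun x => - f x)//.
by apply/funext => x; rewrite scaleN1r.
Qed.

Lemma qintegrable_reflect m n f : qintegrable f -> qintegrable (reflect2 m n f).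
Proof.
have t := lebesgue2_preserving_reflect (R := R) m n.
by move=> [f0 f1 f2 f3]; split;
  [exact: (integrable_preserving t f0)|exact: (integrable_preserving t f1)
  |exact: (integrable_preserving t f2)|exact: (integrable_preserving t f3)].
Qed.

Lemma qintegrable_bndZ (phi : T2 -> R) f : measurable_fun setT phi ->
  (forall x, `|phi x| <= 1) -> qintegrable f ->
  qintegrable (fun x => phi x *: f x).
Proof.
by move=> mphi phi1 [f0 f1 f2 f3]; split;
  [exact: (integrable_bndM f0 mphi phi1)|exact: (integrable_bndM f1 mphi phi1)
  |exact: (integrable_bndM f2 mphi phi1)|exact: (integrable_bndM f3 mphi phi1)].
Qed.

Let eqR (u v : T2 -> R) : u =1 v -> \int[mu]_x u x = \int[mu]_x v x.
Proof. by move=> uv; apply: eq_Rintegral => x _; exact: uv. Qed.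

Lemma qintegralM q f : qintegrable f ->
  qintegral (fun x => q * f x) = q * qintegral f.
Proof.
move=> [f0 f1 f2 f3]; apply: quatP; rewrite /qintegral !quat_mulE /=.
- transitivity (qre q * \int[mu]_x qre (f x) + (- qi q) * \int[mu]_x qi (f x) +
    (- qj q) * \int[mu]_x qj (f x) + (- qk q) * \int[mu]_x qk (f x)); last by ring.
  by rewrite -(Rintegral_comb4 f0 f1 f2 f3); apply: eqR => x; ring.
- transitivity (qi q * \int[mu]_x qre (f x) + qre q * \int[mu]_x qi (f x) +
    (- qk q) * \int[mu]_x qj (f x) + qj q * \int[mu]_x qk (f x)); last by ring.
  by rewrite -(Rintegral_comb4 f0 f1 f2 f3); apply: eqR => x; ring.
- transitivity (qj q * \int[mu]_x qre (f x) + qk q * \int[mu]_x qi (f x) +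
    qre q * \int[mu]_x qj (f x) + (- qi q) * \int[mu]_x qk (f x)); last by ring.
  by rewrite -(Rintegral_comb4 f0 f1 f2 f3); apply: eqR => x; ring.
- transitivity (qk q * \int[mu]_x qre (f x) + (- qj q) * \int[mu]_x qi (f x) +
    qi q * \int[mu]_x qj (f x) + qre q * \int[mu]_x qk (f x)); last by ring.
  by rewrite -(Rintegral_comb4 f0 f1 f2 f3); apply: eqR => x; ring.
Qed.

Lemma qintegralMr q f : qintegrable f ->
  qintegral (fun x => f x * q) = qintegral f * q.
Proof.
move=> [f0 f1 f2 f3]; apply: quatP; rewrite /qintegral !quat_mulE /=.
- transitivity (qre q * \int[mu]_x qre (f x) + (- qi q) * \int[mu]_x qi (f x) +
    (- qj q) * \int[mu]_x qj (f x) + (- qk q) * \int[mu]_x qk (f x)); last by ring.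
  by rewrite -(Rintegral_comb4 f0 f1 f2 f3); apply: eqR => x; ring.
- transitivity (qi q * \int[mu]_x qre (f x) + qre q * \int[mu]_x qi (f x) +
    qk q * \int[mu]_x qj (f x) + (- qj q) * \int[mu]_x qk (f x)); last by ring.
  by rewrite -(Rintegral_comb4 f0 f1 f2 f3); apply: eqR => x; ring.
- transitivity (qj q * \int[mu]_x qre (f x) + (- qk q) * \int[mu]_x qi (f x) +
    qre q * \int[mu]_x qj (f x) + qi q * \int[mu]_x qk (f x)); last by ring.
  by rewrite -(Rintegral_comb4 f0 f1 f2 f3); apply: eqR => x; ring.
- transitivity (qk q * \int[mu]_x qre (f x) + qj q * \int[mu]_x qi (f x) +
    (- qi q) * \int[mu]_x qj (f x) + qre q * \int[mu]_x qk (f x)); last by ring.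
  by rewrite -(Rintegral_comb4 f0 f1 f2 f3); apply: eqR => x; ring.
Qed.

Lemma qintegralD f g : qintegrable f -> qintegrable g ->
  qintegral (fun x => f x + g x) = qintegral f + qintegral g.
Proof.
by move=> [f0 f1 f2 f3] [g0 g1 g2 g3]; apply: quatP;
  rewrite /qintegral !quat_linE /= RintegralD.
Qed.

Lemma qintegral_reflect m n f : qintegrable f ->
  qintegral (reflect2 m n f) = qintegral f.
Proof.
have t := lebesgue2_preserving_reflect (R := R) m n.
by move=> [f0 f1 f2 f3]; apply: quatP;
  [exact: (Rintegral_preserving t f0)|exact: (Rintegral_preserving t f1)
  |exact: (Rintegral_preserving t f2)|exact: (Rintegral_preserving t f3)].
Qed.

End QuaternionIntegral.

(** * Convolution and trigonometric moments *)

Section QuaternionConvolution.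
Set Implicit Arguments.
Unset Strict Implicit.
Context {R : realType}.
Local Notation T2 := (measurableTypeR R * measurableTypeR R)%type.
Local Notation mu := (@lebesgue2 R).
Implicit Types (f g : R * R -> quat R).

Definition sel4 (A : Type) (a0 a1 a2 a3 : A) (i : 'I_4) : A :=
  match val i with 0%N => a0 | 1%N => a1 | 2%N => a2 | _ => a3 end.

Lemma sel4P (A : Type) (P : A -> Prop) (a0 a1 a2 a3 : A) :
  P a0 -> P a1 -> P a2 -> P a3 -> forall i, P (sel4 a0 a1 a2 a3 i).
Proof. by move=> ? ? ? ?; case=> [[|[|[|]]]]. Qed.

Lemma sel4E (A : Type) (a0 a1 a2 a3 : A) :
  (sel4 a0 a1 a2 a3 0 = a0) * (sel4 a0 a1 a2 a3 1 = a1) *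
  (sel4 a0 a1 a2 a3 2 = a2) * (sel4 a0 a1 a2 a3 3 = a3).
Proof. by []. Qed.

Section Moment.
Variables (f g : R * R -> quat R).
Hypotheses (intf : qintegrable f) (intg : qintegrable g).

Let fc := sel4 (fun x => qre (f x)) (fun x => qi (f x)) (fun x => qj (f x))
  (fun x => qk (f x)).

Let intfc i : mu.-integrable setT (EFin \o (fc i : T2 -> R)).
Proof.
by case: intf => ? ? ? ?;
  exact: (@sel4P _ (fun h : T2 -> R => mu.-integrable setT (EFin \o h) : Prop)).
Qed.

(* One component of [qconv f g]: [v] lists the components of [g] in the order in
   which they meet those of [f], [c] the signs of the four products. *)
Let component (c : 'I_4 -> R) (v : 'I_4 -> T2 -> R) (x : T2) : R :=
  \int[mu]_y (c 0 * (fc 0 y * v 0 (x.1 - y.1, x.2 - y.2)) +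
    c 1 * (fc 1 y * v 1 (x.1 - y.1, x.2 - y.2)) +
    c 2 * (fc 2 y * v 2 (x.1 - y.1, x.2 - y.2)) +
    c 3 * (fc 3 y * v 3 (x.1 - y.1, x.2 - y.2))).

Let g0 (x : T2) := qre (g x).
Let g1 (x : T2) := qi (g x).
Let g2 (x : T2) := qj (g x).
Let g3 (x : T2) := qk (g x).

Let selg (h0 h1 h2 h3 : T2 -> R) : 
  mu.-integrable setT (EFin \o h0) -> mu.-integrable setT (EFin \o h1) ->
  mu.-integrable setT (EFin \o h2) -> mu.-integrable setT (EFin \o h3) ->
  forall i, mu.-integrable setT (EFin \o sel4 h0 h1 h2 h3 i).
Proof.
exact: (@sel4P _ (fun h : T2 -> R => mu.-integrable setT (EFin \o h) : Prop)).
Qed.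

Let qreE x : qre (qconv f g x) =
  component (sel4 1 (-1) (-1) (-1)) (sel4 g0 g1 g2 g3) x.
Proof. by apply: eq_Rintegral => y _; rewrite qreM /fc !sel4E /g0 /g1 /g2 /g3; ring. Qed.
Let qiE x : qi (qconv f g x) =
  component (sel4 1 1 1 (-1)) (sel4 g1 g0 g3 g2) x.
Proof. by apply: eq_Rintegral => y _; rewrite qiM /fc !sel4E /g0 /g1 /g2 /g3; ring. Qed.
Let qjE x : qj (qconv f g x) =
  component (sel4 1 (-1) 1 1) (sel4 g2 g3 g0 g1) x.
Proof. by apply: eq_Rintegral => y _; rewrite qjM /fc !sel4E /g0 /g1 /g2 /g3; ring. Qed.
Let qkE x : qk (qconv f g x) =
  component (sel4 1 1 (-1) 1) (sel4 g3 g2 g1 g0) x.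
Proof. by apply: eq_Rintegral => y _; rewrite qkM /fc !sel4E /g0 /g1 /g2 /g3; ring. Qed.

Lemma qintegrable_qconv : qintegrable (qconv f g).
Proof.
case: intg => i0 i1 i2 i3.
split.
- rewrite (_ : (fun x => _) = EFin \o component (sel4 1 (-1) (-1) (-1)) (sel4 g0 g1 g2 g3)).
    by apply: integrable_rconv_comb4 => //; exact: selg.
  by apply/funext => x; rewrite qreE.
- rewrite (_ : (fun x => _) = EFin \o component (sel4 1 1 1 (-1)) (sel4 g1 g0 g3 g2)).
    by apply: integrable_rconv_comb4 => //; exact: selg.
  by apply/funext => x; rewrite qiE.
- rewrite (_ : (fun x => _) = EFin \o component (sel4 1 (-1) 1 1) (sel4 g2 g3 g0 g1)).
    by apply: integrable_rconv_comb4 => //; exact: selg.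
  by apply/funext => x; rewrite qjE.
- rewrite (_ : (fun x => _) = EFin \o component (sel4 1 1 (-1) 1) (sel4 g3 g2 g1 g0)).
    by apply: integrable_rconv_comb4 => //; exact: selg.
  by apply/funext => x; rewrite qkE.
Qed.

Variables (phi : T2 -> R) (p q : 'I_4 -> T2 -> R) (c : 'I_4 -> R).
Hypotheses (mphi : measurable_fun setT phi) (phi1 : forall x, `|phi x| <= 1).
Hypotheses (mp : forall i, measurable_fun setT (p i))
  (p1 : forall i x, `|p i x| <= 1).
Hypotheses (mq : forall i, measurable_fun setT (q i))
  (q1 : forall i x, `|q i x| <= 1).
Hypothesis phiE : forall y z, phi (z.1 + y.1, z.2 + y.2) =
    c 0 * (p 0 y * q 0 z) + c 1 * (p 1 y * q 1 z) +
    c 2 * (p 2 y * q 2 z) + c 3 * (p 3 y * q 3 z).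

Let Jp i := qintegral (fun x => p i x *: f x).
Let Jq i := qintegral (fun x => q i x *: g x).

(** In each component [main] reduces to moments of real convolutions and [conv] factors these. The
    weights are real, hence central, so the moments of [f] stay to the left of those of [g]. *)
Lemma qintegral_qconv : qintegral (fun x => phi x *: qconv f g x) =
  c 0 *: (Jp 0 * Jq 0) + c 1 *: (Jp 1 * Jq 1) +
  c 2 *: (Jp 2 * Jq 2) + c 3 *: (Jp 3 * Jq 3).
Proof.
case: intf => a0 a1 a2 a3; case: intg => i0 i1 i2 i3.
have main s k : (forall i, mu.-integrable setT (EFin \o (k i : T2 -> R))) ->
    \int[mu]_x (phi x * component s k x) =
    s 0 * \int[mu]_x (phi x * rconv (fc 0) (k 0) x) +
    s 1 * \int[mu]_x (phi x * rconv (fc 1) (k 1) x) +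
    s 2 * \int[mu]_x (phi x * rconv (fc 2) (k 2) x) +
    s 3 * \int[mu]_x (phi x * rconv (fc 3) (k 3) x).
  by move=> ik; exact: (Rintegral_rconv_comb4r _ intfc ik mphi phi1).
have conv u v : mu.-integrable setT (EFin \o u) ->
    mu.-integrable setT (EFin \o v) -> \int[mu]_x (phi x * rconv u v x) = _ :=
  fun iu iv => Rintegral_rconv_comb4 iu iv mphi phi1 mp p1 mq q1 phiE.
apply: quatP; rewrite !quat_linE !quat_mulE /=.
- transitivity (\int[mu]_x (phi x * component (sel4 1 (-1) (-1) (-1)) (sel4 g0 g1 g2 g3) x)).
    by apply: eq_Rintegral => x _; rewrite -qreE.
  by rewrite (main _ _ (selg i0 i1 i2 i3)) /fc !sel4E /g0 /g1 /g2 /g3 !conv//; ring.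
- transitivity (\int[mu]_x (phi x * component (sel4 1 1 1 (-1)) (sel4 g1 g0 g3 g2) x)).
    by apply: eq_Rintegral => x _; rewrite -qiE.
  by rewrite (main _ _ (selg i1 i0 i3 i2)) /fc !sel4E /g0 /g1 /g2 /g3 !conv//; ring.
- transitivity (\int[mu]_x (phi x * component (sel4 1 (-1) 1 1) (sel4 g2 g3 g0 g1) x)).
    by apply: eq_Rintegral => x _; rewrite -qjE.
  by rewrite (main _ _ (selg i2 i3 i0 i1)) /fc !sel4E /g0 /g1 /g2 /g3 !conv//; ring.
- transitivity (\int[mu]_x (phi x * component (sel4 1 1 (-1) 1) (sel4 g3 g2 g1 g0) x)).
    by apply: eq_Rintegral => x _; rewrite -qkE.
  by rewrite (main _ _ (selg i3 i2 i1 i0)) /fc !sel4E /g0 /g1 /g2 /g3 !conv//; ring.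
Qed.

End Moment.
End QuaternionConvolution.

(** * Cosine and sine moments of quaternion functions *)

Section TrigonometricMoments.
Set Implicit Arguments.
Unset Strict Implicit.
Context {R : realType}.
Local Notation T2 := (measurableTypeR R * measurableTypeR R)%type.
Local Notation mu := (@lebesgue2 R).
Implicit Types (f g : R * R -> quat R) (y : R * R).

(** The boolean is the parity of the function, [true] for odd; it serves as the exponent of the sign
    under reflection. *)
Definition trig (b : bool) (t : R) : R := if b then sin t else cos t.

Definition trig2 (b1 b2 : bool) y (x : T2) : R :=
  trig b1 (x.1 * y.1) * trig b2 (x.2 * y.2).

Lemma trig_le1 b t : `|trig b t| <= 1.
Proof. by case: b; [exact: sin_max|exact: cos_max]. Qed.

Lemma trig2_le1 b1 b2 y x : `|trig2 b1 b2 y x| <= 1.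
Proof.
rewrite normrM -[X in _ <= X]mulr1.
by apply: ler_pM => //; exact: trig_le1.
Qed.

Lemma measurable_trig2 b1 b2 y : measurable_fun setT (trig2 b1 b2 y).
Proof.
have m b : measurable_fun setT (trig b).
  by case: b; apply: continuous_measurable_fun;
    [exact: continuous_sin|exact: continuous_cos].
by apply: measurable_funM; apply: (measurableT_comp (m _)); apply: measurable_funM.
Qed.

Lemma trigD b s t : trig b (s + t) =
  trig b s * trig false t + (-1) ^+ (~~ b) * (trig (~~ b) s * trig true t).
Proof.
by case: b; rewrite /trig /= ?sinD ?cosD ?expr0 ?expr1; ring.
Qed.

Lemma trigN b t : trig b (- t) = (-1) ^+ b * trig b t.
Proof. by case: b; rewrite /trig /= ?sinN ?cosN ?expr0 ?expr1; ring. Qed.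

Definition moment (b1 b2 : bool) f y : quat R :=
  qintegral (fun x => trig2 b1 b2 y x *: f x).

Let bnd b1 b2 y f : qintegrable f ->
  qintegrable (fun x => trig2 b1 b2 y x *: f x).
Proof.
exact: (qintegrable_bndZ (measurable_trig2 b1 b2 y) (trig2_le1 b1 b2 y)).
Qed.

Lemma momentM b1 b2 q f y : qintegrable f ->
  moment b1 b2 (fun x => q * f x) y = q * moment b1 b2 f y.
Proof.
move=> intf; rewrite /moment -qintegralM; last exact: bnd.
by congr qintegral; apply/funext => x; rewrite scalerAr.
Qed.

Lemma momentMr b1 b2 q f y : qintegrable f ->
  moment b1 b2 (fun x => f x * q) y = moment b1 b2 f y * q.
Proof.
move=> intf; rewrite /moment -qintegralMr; last exact: bnd.
by congr qintegral; apply/funext => x; rewrite scalerAl.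
Qed.

Lemma momentD b1 b2 f g y : qintegrable f -> qintegrable g ->
  moment b1 b2 (fun x => f x + g x) y = moment b1 b2 f y + moment b1 b2 g y.
Proof.
move=> intf intg; rewrite /moment -qintegralD; try exact: bnd.
by congr qintegral; apply/funext => x; rewrite scalerDr.
Qed.

Lemma momentZ b1 b2 a f y : qintegrable f ->
  moment b1 b2 (fun x => a *: f x) y = a *: moment b1 b2 f y.
Proof.
move=> intf; have := momentM b1 b2 a%:A y intf.
rewrite -scalerAl mul1r => <-; congr (moment _ _ _ y).
by apply/funext => x; rewrite -scalerAl mul1r.
Qed.

Lemma momentN b1 b2 f y : qintegrable f ->
  moment b1 b2 (fun x => - f x) y = - moment b1 b2 f y.
Proof.
move=> intf; rewrite -scaleN1r -momentZ//; congr (moment _ _ _ y).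
by apply/funext => x; rewrite scaleN1r.
Qed.

(** The integral on the right is reflected as well. This produces the parity sign of the
    trigonometric factors a second time, and the two signs cancel. *)
Lemma moment_reflect b1 b2 (m n : nat) f y : qintegrable f ->
  moment b1 b2 (reflect2 m n f) y =
    ((-1) ^+ (m * b1) * (-1) ^+ (n * b2)) *: moment b1 b2 f y.
Proof.
move=> intf; rewrite -momentZ// /moment -[RHS](qintegral_reflect m n); last first.
  exact/bnd/qintegrableZ.
have sgnM (b : bool) k t u :
    trig b ((-1) ^+ k * t * u) = (-1) ^+ (k * b) * trig b (t * u).
  rewrite -!(signr_odd _ k) -(signr_odd _ (k * b)) oddM.
  case: (odd k); rewrite /= ?expr0 ?expr1 ?mul1r// mulN1r mulNr trigN.
  by case: b.
congr qintegral; apply/funext => x; rewrite /reflect2 /trig2 /= !sgnM.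
rewrite scalerA; congr (_ *: _).
have sq k (b : bool) : (-1) ^+ (k * b) * (-1) ^+ (k * b) = 1 :> R.
  by rewrite -expr2 sqrr_sign.
move: (sq m b1) (sq n b2); set a := _ ^+ (m * b1); set b := _ ^+ (n * b2).
move: (trig b1 _) (trig b2 _) => t1 t2 ha hb.
by rewrite -[LHS]mul1r -[1 in LHS]mulr1 -{1}ha -hb; ring.
Qed.

(** The addition formulas in both coordinates: a sine falling on [g] flips the corresponding index
    of [f], with a minus sign when the function expanded is a cosine. *)
Lemma moment_qconv b1 b2 f g y : qintegrable f -> qintegrable g ->
  moment b1 b2 (qconv f g) y =
    moment b1 b2 f y * moment false false g y +
    (-1) ^+ (~~ b2) *: (moment b1 (~~ b2) f y * moment false true g y) +
    (-1) ^+ (~~ b1) *: (moment (~~ b1) b2 f y * moment true false g y) +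
    ((-1) ^+ (~~ b1) * (-1) ^+ (~~ b2)) *:
      (moment (~~ b1) (~~ b2) f y * moment true true g y).
Proof.
move=> intf intg.
rewrite /moment (qintegral_qconv intf intg (phi := trig2 b1 b2 y)
  (p := sel4 (trig2 b1 b2 y) (trig2 b1 (~~ b2) y) (trig2 (~~ b1) b2 y)
    (trig2 (~~ b1) (~~ b2) y))
  (q := sel4 (trig2 false false y) (trig2 false true y) (trig2 true false y)
    (trig2 true true y))
  (c := sel4 1 ((-1) ^+ (~~ b2)) ((-1) ^+ (~~ b1))
    ((-1) ^+ (~~ b1) * (-1) ^+ (~~ b2)))).
- by rewrite !sel4E scale1r.
- exact: measurable_trig2.
- exact: trig2_le1.
- by apply: (sel4P (P := fun h : T2 -> R => measurable_fun setT h));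
    exact: measurable_trig2.
- by apply: (sel4P (P := fun h : T2 -> R => forall x, `|h x| <= 1));
    exact: trig2_le1.
- by apply: (sel4P (P := fun h : T2 -> R => measurable_fun setT h));
    exact: measurable_trig2.
- by apply: (sel4P (P := fun h : T2 -> R => forall x, `|h x| <= 1));
    exact: trig2_le1.
- move=> x z; rewrite !sel4E /trig2 /= (addrC z.1) (addrC z.2) !mulrDl.
  by rewrite !trigD /=; move: (_ ^+ (~~ b1)) (_ ^+ (~~ b2)) => s1 s2; ring.
Qed.

(** Signs as negations instead of scalars: on concrete booleans they reduce to the plain ring
    expressions of the algebraic identities. *)
Definition negq (b : bool) (q : quat R) : quat R := if b then - q else q.

Let signqE (b : bool) q : (-1) ^+ b *: q = negq b q.
Proof. by case: b; rewrite /= ?expr0 ?expr1 ?scale1r ?scaleN1r. Qed.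

Lemma moment_qconvE b1 b2 f g y : qintegrable f -> qintegrable g ->
  moment b1 b2 (qconv f g) y =
    moment b1 b2 f y * moment false false g y +
    negq (~~ b2) (moment b1 (~~ b2) f y * moment false true g y) +
    negq (~~ b1) (moment (~~ b1) b2 f y * moment true false g y) +
    negq (~~ b1 (+) ~~ b2)
      (moment (~~ b1) (~~ b2) f y * moment true true g y).
Proof. by move=> intf intg; rewrite moment_qconv// -signr_addb !signqE. Qed.

Lemma moment_reflect01 b1 b2 f y : qintegrable f ->
  moment b1 b2 (reflect2 0 1 f) y = negq b2 (moment b1 b2 f y).
Proof.
by move=> ?; rewrite moment_reflect// mul0n mul1n expr0 mul1r signqE.
Qed.

Lemma moment_reflect10 b1 b2 f y : qintegrable f ->
  moment b1 b2 (reflect2 1 0 f) y = negq b1 (moment b1 b2 f y).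
Proof.
by move=> ?; rewrite moment_reflect// mul0n mul1n expr0 mulr1 signqE.
Qed.

Lemma moment_reflect11 b1 b2 f y : qintegrable f ->
  moment b1 b2 (reflect2 1 1 f) y = negq b1 (negq b2 (moment b1 b2 f y)).
Proof. by move=> ?; rewrite moment_reflect// !mul1n -scalerA !signqE. Qed.

(** Every plane wave is a combination of the four products of trigonometric functions at the
    frequency (s, t), so each component is orthogonal to all plane waves. *)
Lemma moments_uniqueness f : qintegrable f ->
  (forall b1 b2 y, moment b1 b2 f y = 0) ->
  {ae mu, forall x, f x = 0}.
Proof.
move=> [f0 f1 f2 f3] mf.
have main (h : T2 -> R) : mu.-integrable setT (EFin \o h) ->
    (forall b1 b2 y, \int[mu]_x (trig2 b1 b2 y x * h x) = 0) ->
    {ae mu, forall x, h x = 0}.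
  move=> ih h0; apply: plane_wave_uniqueness => // s t b.
  have ib b1 b2 y := integrable_bndM ih (measurable_trig2 b1 b2 y)
    (trig2_le1 b1 b2 y).
  pose y := (s, t).
  transitivity (\int[mu]_x (cos b * (trig2 false false y x * h x) +
    (- sin b) * (trig2 false true y x * h x) +
    (- sin b) * (trig2 true false y x * h x) +
    (- cos b) * (trig2 true true y x * h x))).
    apply: eq_Rintegral => x _; rewrite /plane_wave /trig2 /trig /=.
    rewrite (mulrC s) (mulrC t).
    move: (x.1 * s) (x.2 * t) => A B.
    rewrite cosD; move: (cosD A B) (sinD A B) => -> ->; ring.
  by rewrite Rintegral_comb4// !h0 !mulr0 !addr0.
have [z0 z1 z2 z3] : [/\ {ae mu, forall x : T2, qre (f x) = 0},
    {ae mu, forall x : T2, qi (f x) = 0}, {ae mu, forall x : T2, qj (f x) = 0} &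
    {ae mu, forall x : T2, qk (f x) = 0}].
  by split; apply: main => // b1 b2 y; have := mf b1 b2 y; case.
suff : {ae mu, forall x : T2, f x = 0} by [].
apply: filterS2 (filterI z0 z1) (filterI z2 z3) => x [h0 h1] [h2 h3].
exact: quatP.
Qed.

End TrigonometricMoments.

(** * The identities in an algebra with two anticommuting units *)

Section AnticommutingUnits.
Set Implicit Arguments.
Unset Strict Implicit.
Context {R : realType} {A : nzRingType} (mu nu : A).
Hypotheses (mu2 : mu ^+ 2 = -1) (nu2 : nu ^+ 2 = -1).
Hypothesis munu : mu * nu + nu * mu = 0.

(** The expansion of (cos - mu sin)(cos - nu sin), with the moments in the order cos cos, cos sin,
    sin cos, sin sin. *)
Definition ft_comb (a b c d : A) : A := a - nu * b - mu * c + mu * (nu * d).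

Lemma ft_combD a b c d a' b' c' d' :
  ft_comb (a + a') (b + b') (c + c') (d + d') =
  ft_comb a b c d + ft_comb a' b' c' d'.
Proof.
rewrite /ft_comb !mulrDr !opprD.
by rewrite (addrACA a) (addrACA (a - _)) (addrACA (a - _ - _)).
Qed.

Lemma ft_combN a b c d : ft_comb (- a) (- b) (- c) (- d) = - ft_comb a b c d.
Proof. by rewrite /ft_comb !mulrN !opprD !opprK. Qed.

Lemma mulKNmu q : mu * (mu * q) = - q.
Proof. by rewrite mulrA -expr2 mu2 mulN1r. Qed.

Lemma mulKNnu q : nu * (nu * q) = - q.
Proof. by rewrite mulrA -expr2 nu2 mulN1r. Qed.

Lemma mul_nu_mu q : nu * (mu * q) = - (mu * (nu * q)).
Proof.
by rewrite !mulrA -mulNr; congr (_ * _); apply/eqP; rewrite -addr_eq0 addrC munu.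
Qed.

(* Right-associated normal form with [mu] on the left of [nu]. *)
Let normE := (@mulrDr A, @mulrDl A, @mulrN A, @mulNr A, @opprK A, @opprD A,
  fun p q r : A => esym (mulrA p q r), mul_nu_mu, mulKNmu, mulKNnu).

(* Additive maps to [R] turn identities of [A] into commutative ones, which
   [ring] decides once the products are in normal form. *)
Variables (e : A -> R) (eD : {morph e : p q / p + q >-> p + q})
  (eN : {morph e : p / - p >-> - p}).

(** With F = ft_comb a b c d, the four terms on the left are F a', - F nu b', - F mu c' and F mu nu
    d', the expansion of the product on the right. The signs of [b] and [d] in the last two come
    from the reflection, which compensates for mu nu = - nu mu. *)
Lemma mustard_identity a b c d a' b' c' d' :
  let w1 x := nu * (x * nu) in let w2 x := mu * (x * mu) in
  let w3 x := (mu * nu) * (x * (mu * nu)) in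
  e (ft_comb (a * a') (b * a') (c * a') (d * a')
    - ft_comb (- (w1 b * b')) (w1 a * b') (- (w1 d * b')) (w1 c * b')
    - ft_comb (- (w2 c * c')) (- (w2 (- d) * c')) (w2 a * c') (w2 (- b) * c')
    - ft_comb (w3 (- d) * d') (- (w3 c * d')) (- (w3 (- b) * d')) (w3 a * d'))
  = e (ft_comb a b c d * ft_comb a' b' c' d').
Proof. by rewrite /= /ft_comb !normE !(eD, eN); ring. Qed.

Let e_mul_ft_comb F p q r s : e (F * ft_comb p q r s) =
  e (F * p) - e (F * (nu * q)) - e (F * (mu * r)) + e (F * (mu * (nu * s))).
Proof. by rewrite /ft_comb !mulrDr !mulrN !(eD, eN). Qed.

(** In [G] the functions [s] and [t] are the signs that reflections of [g] in the first and second
    coordinate put on its moments. The right side holds the moments of the classical convolution. *)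
Lemma convolution_identity a b c d a' b' c' d' :
  let F x := ft_comb (x * a) (x * b) (x * c) (x * d) in
  let F01 x := ft_comb (x * a) (x * - b) (x * c) (x * - d) in
  let G s t x :=
    ft_comb (x * a') (x * (t b')) (x * (s c')) (x * (s (t d'))) in
  let p := id in let n x := - x in
  e (F 1 * G p p 1 + F 1 * G p n 1 + F 1 * G n p 1 + F 1 * G n n 1
    - F nu * G p p nu + F nu * G p n nu
    - F nu * G n p nu + F nu * G n n nu
    - F01 mu * G p p mu - F01 mu * G p n mu
    + F01 mu * G n p mu + F01 mu * G n n mu
    + F01 (nu * mu) * G p p (mu * nu) - F01 (nu * mu) * G p n (mu * nu)
    - F01 (nu * mu) * G n p (mu * nu) + F01 (nu * mu) * G n n (mu * nu)) =
  4 * e (ft_comb (a * a' - b * b' - c * c' + d * d')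
    (b * a' + a * b' - d * c' - c * d')
    (c * a' - d * b' + a * c' - b * d')
    (d * a' + c * b' + b * c' + a * d')).
Proof.
move=> F F01 G p n.
(* In each group of four terms the signs cancel all moments of [g] but one, which is left with the
   factor 4. *)
transitivity (4 * (e (F 1 * a') + e (F nu * (nu * (nu * b'))) +
  e (F01 mu * (mu * (mu * c'))) +
  e (F01 (nu * mu) * (mu * (nu * (mu * (nu * d'))))))).
  rewrite !(eD, eN) /G /p /n !e_mul_ft_comb !mul1r !mulrN !eN -!mulrA; ring.
by rewrite /F /F01 /ft_comb !mul1r !normE !(eD, eN); ring.
Qed.

End AnticommutingUnits.

(** * Fourier transform and Mustard convolution *)

Section FourierTransform.
Set Implicit Arguments.
Unset Strict Implicit.
Context {R : realType}.
Local Notation T2 := (measurableTypeR R * measurableTypeR R)%type.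
Variables (mu nu : quat R).
Hypotheses (mu2 : mu ^+ 2 = -1) (nu2 : nu ^+ 2 = -1).
Hypothesis munu : mu * nu + nu * mu = 0.
Implicit Types (f g h : R * R -> quat R) (y : R * R).

(** This is 2 pi times the transform of an integrable [f]; in this scale the equation defining the
    Mustard convolution has no constant. *)
Definition ft f y : quat R :=
  ft_comb mu nu (moment false false f y) (moment false true f y)
    (moment true false f y) (moment true true f y).

Lemma qftE f y : qintegrable f -> qft mu nu f y = (2 * pi)^-1 *: ft f y.
Proof.
move=> intf; rewrite /qft; congr (_ *: _).
have bnd b1 b2 : qintegrable (fun x => trig2 b1 b2 y x *: f x).
  exact: (qintegrable_bndZ (measurable_trig2 b1 b2 y) (trig2_le1 b1 b2 y)).
transitivity (qintegral (fun x => trig2 false false y x *: f x +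
   (- nu) * (trig2 false true y x *: f x) +
   (- mu) * (trig2 true false y x *: f x) +
   (mu * nu) * (trig2 true true y x *: f x))).
  congr qintegral; apply/funext => x; rewrite /qexp /trig2 /trig !sinN !cosN.
  by apply: quatP; rewrite !(quat_linE, quat_mulE) /=; ring.
rewrite !qintegralD ?qintegralM//;
  by rewrite ?mulNr -?mulrA//; do ?[exact: qintegrableM|apply: qintegrableD].
Qed.

Definition has_ft h (H : R * R -> quat R) : Prop :=
  qintegrable h /\ forall y, ft h y = H y.

Lemma has_ftD h H k K : has_ft h H -> has_ft k K ->
  has_ft (fun x => h x + k x) (fun y => H y + K y).
Proof.
move=> [ih hH] [ik kK]; split; first exact: qintegrableD.
by move=> y; rewrite -hH -kK /ft !momentD// ft_combD.
Qed.

Lemma has_ftZ a h H : has_ft h H ->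
  has_ft (fun x => a *: h x) (fun y => a *: H y).
Proof.
move=> [ih hH]; split; first exact: qintegrableZ.
by move=> y; rewrite -hH /ft /ft_comb !momentZ// -!scalerAr -!scalerN -!scalerDr.
Qed.

Lemma has_ftN h H : has_ft h H -> has_ft (fun x => - h x) (fun y => - H y).
Proof.
move=> [ih hH]; split; first exact: qintegrableN.
by move=> y; rewrite -hH /ft !momentN// ft_combN.
Qed.

(** Position and frequency enter only through the products x_i y_i, so changing the sign of a
    frequency amounts to reflecting the function. *)
Lemma moment_freq b1 b2 (m n : nat) f y : qintegrable f ->
  moment b1 b2 f ((-1) ^+ m * y.1, (-1) ^+ n * y.2) =
    ((-1) ^+ (m * b1) * (-1) ^+ (n * b2)) *: moment b1 b2 f y.
Proof.
move=> intf; rewrite -moment_reflect// /moment.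
rewrite -[RHS](qintegral_reflect m n); last first.
  apply: (qintegrable_bndZ (measurable_trig2 b1 b2 y) (trig2_le1 b1 b2 y)).
  exact: qintegrable_reflect.
congr qintegral; apply/funext => x; rewrite /reflect2 /trig2 /=.
have sq k (t : R) : (-1) ^+ k * ((-1) ^+ k * t) = t.
  by rewrite mulrA -expr2 sqrr_sign mul1r.
rewrite !sq -surjective_pairing.
by congr (_ *: _); congr (trig _ _ * trig _ _); ring.
Qed.

(** The values at the four frequencies (+-y_1, +-y_2) form an invertible linear system in a, nu b,
    mu c and mu nu d. All four vanish, and the units [mu] and [nu] can be cancelled. *)
Lemma ft_eq0 h : qintegrable h -> (forall y, ft h y = 0) ->
  {ae @lebesgue2 R, forall x, h x = 0}.
Proof.
move=> ih h0; apply: moments_uniqueness => // b1 b2 y.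
have E m n := h0 ((-1) ^+ m * y.1, (-1) ^+ n * y.2).
move: (E 0%N 0%N) (E 0%N 1%N) (E 1%N 0%N) (E 1%N 1%N).
rewrite /ft /ft_comb !moment_freq// /= !(muln0, muln1, mul0n, expr0, expr1).
rewrite !(mul1r, mulr1) mulrNN mulr1 !(scale1r, scaleN1r) !mulrN !opprK.
move=> E00 E01 E10 E11.
set a := moment false false h y in E00 E01 E10 E11 *.
set b := moment false true h y in E00 E01 E10 E11 *.
set c := moment true false h y in E00 E01 E10 E11 *.
set d := moment true true h y in E00 E01 E10 E11 *.
have comp (e : quat R -> R) (eD : {morph e : p q / p + q >-> p + q})
    (eN : {morph e : p / - p >-> - p}) (e0 : e 0 = 0) :
    [/\ e a = 0, e (nu * b) = 0, e (mu * c) = 0 & e (mu * (nu * d)) = 0].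
  move: (congr1 e E00) (congr1 e E01) (congr1 e E10) (congr1 e E11).
  by rewrite !(eD, eN) e0 => ? ? ? ?; split; lra.
have [a0 b0 c0 d0] : [/\ a = 0, nu * b = 0, mu * c = 0 & mu * (nu * d) = 0].
  have [? ? ? ?] := comp (@qre R) (@qreD R) (@qreN R) erefl.
  have [? ? ? ?] := comp (@qi R) (@qiD R) (@qiN R) erefl.
  have [? ? ? ?] := comp (@qj R) (@qjD R) (@qjN R) erefl.
  have [? ? ? ?] := comp (@qk R) (@qkD R) (@qkN R) erefl.
  by split; exact: quatP.
have mu_eq0 q : mu * q = 0 -> q = 0.
  by move=> q0; apply: oppr_inj; rewrite -(mulKNmu mu2) q0 mulr0 oppr0.
have nu_eq0 q : nu * q = 0 -> q = 0.
  by move=> q0; apply: oppr_inj; rewrite -(mulKNnu nu2) q0 mulr0 oppr0.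
by case: b1 b2 => [] [];
  [exact/nu_eq0/mu_eq0|exact: mu_eq0|exact: nu_eq0|exact: a0].
Qed.

Lemma ft_unique h H k : has_ft h H -> qintegrable k ->
  (forall y, ft k y = H y) -> {ae @lebesgue2 R, forall x : T2, k x = h x}.
Proof.
move=> hH ik kH.
have [id d0] := has_ftD (conj ik kH) (has_ftN hH).
have : {ae @lebesgue2 R, forall x : T2, k x - h x = 0}.
  by apply: (ft_eq0 id) => y; rewrite d0 subrr.
by apply: filterS => x /eqP; rewrite subr_eq0 => /eqP.
Qed.

(** The projection onto functions of parity [s] in the first and [t] in the second variable, [true]
    meaning odd. *)
Definition parity_part (s t : bool) g (x : R * R) : quat R := 4^-1 *:
  (g x + (-1) ^+ t *: reflect2 0 1 g x + (-1) ^+ s *: reflect2 1 0 g x +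
   ((-1) ^+ s * (-1) ^+ t) *: reflect2 1 1 g x).

Lemma qintegrable_parity_part s t g : qintegrable g ->
  qintegrable (parity_part s t g).
Proof.
move=> ig; apply: qintegrableZ.
by do ?[apply: qintegrableD => //]; apply: qintegrableZ; exact: qintegrable_reflect.
Qed.

Lemma moment_parity_part b1 b2 s t g y : qintegrable g ->
  moment b1 b2 (parity_part s t g) y =
  if (b1 == s) && (b2 == t) then moment b1 b2 g y else 0.
Proof.
move=> ig; have ir m n := qintegrable_reflect m n ig.
have irz m n a := qintegrableZ a (ir m n).
rewrite momentZ; last by do ?[apply: qintegrableD => //].
rewrite !momentD//; do ?[exact: qintegrableD]; last first.
  by apply: qintegrableD => //; exact: qintegrableD.
rewrite !momentZ// !moment_reflect//.
by case: b1 b2 s t => -[] [] []; apply: quatP; rewrite !quat_linE /=; field.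
Qed.

(** The second factor has only its (s, t) moment, so one of the four terms of the addition formula
    survives. *)
Lemma moment_qconv_parity_part b1 b2 s t f g y :
  qintegrable f -> qintegrable g ->
  moment b1 b2 (qconv f (parity_part s t g)) y =
  negq ((~~ b1 && s) (+) (~~ b2 && t))
    (moment (b1 (+) s) (b2 (+) t) f y * moment s t g y).
Proof.
move=> intf intg; have ip := qintegrable_parity_part s t intg.
have neg0 b : negq b (0 : quat R) = 0 by case: b; rewrite //= oppr0.
rewrite moment_qconvE// !moment_parity_part//.
by case: s t {ip} => [] [] /=; rewrite !mulr0 !neg0 !(add0r, addr0)
  ?(addbT, addbF, andbT, andbF).
Qed.

(* With g_ee, g_eo, g_oe, g_oo the parity parts of g, the witness is
   f * g_ee - (nu f nu) * g_eo - (mu f^(0,1) mu) * g_oe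
     - (mu nu f^(0,1) mu nu) * g_oo. *)
Lemma mustard_exists f g : qintegrable f -> qintegrable g ->
  exists h, has_ft h (fun y => ft f y * ft g y).
Proof.
move=> intf intg; have if01 := qintegrable_reflect 0 1 intf.
have ip s t := qintegrable_parity_part s t intg.
have ift (h : R * R -> quat R) : qintegrable h -> has_ft h (ft h) by [].
pose w1 x := nu * (f x * nu).
pose w2 x := mu * (reflect2 0 1 f x * mu).
pose w3 x := (mu * nu) * (reflect2 0 1 f x * (mu * nu)).
have i1 : qintegrable w1 by apply/qintegrableM/qintegrableMr.
have i2 : qintegrable w2 by apply/qintegrableM/qintegrableMr.
have i3 : qintegrable w3 by apply/qintegrableM/qintegrableMr.
have c0 := ift _ (qintegrable_qconv intf (ip false false)).
have c1 := has_ftN (ift _ (qintegrable_qconv i1 (ip false true))).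
have c2 := has_ftN (ift _ (qintegrable_qconv i2 (ip true false))).
have c3 := has_ftN (ift _ (qintegrable_qconv i3 (ip true true))).
have [ih hE] := has_ftD (has_ftD (has_ftD c0 c1) c2) c3.
eexists; split; first exact: ih.
move=> y; rewrite hE /ft !moment_qconv_parity_part//.
have m1 b1 b2 : moment b1 b2 w1 y = nu * (moment b1 b2 f y * nu).
  by rewrite momentM ?momentMr//; exact: qintegrableMr.
have m2 b1 b2 : moment b1 b2 w2 y = mu * (negq b2 (moment b1 b2 f y) * mu).
  by rewrite momentM ?momentMr ?moment_reflect01//; exact: qintegrableMr.
have m3 b1 b2 : moment b1 b2 w3 y =
    (mu * nu) * (negq b2 (moment b1 b2 f y) * (mu * nu)).
  by rewrite momentM ?momentMr ?moment_reflect01//; exact: qintegrableMr.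
rewrite !m1 !m2 !m3.
apply: quatP.
- exact: (mustard_identity mu2 nu2 munu (@qreD R) (@qreN R)).
- exact: (mustard_identity mu2 nu2 munu (@qiD R) (@qiN R)).
- exact: (mustard_identity mu2 nu2 munu (@qjD R) (@qjN R)).
- exact: (mustard_identity mu2 nu2 munu (@qkD R) (@qkN R)).
Qed.

Lemma mustardP f g : qintegrable f -> qintegrable g ->
  has_ft (mustard mu nu f g) (fun y => ft f y * ft g y).
Proof.
move=> intf intg; have [h [ih hE]] := mustard_exists intf intg.
have p0 : 2 * pi != 0 :> R by rewrite mulf_neq0// gt_eqF// pi_gt0.
(* The function chosen satisfies the defining equation; the default value is ruled out by the
   witness [h]. *)
rewrite /mustard; case: xgetP => [k _ [ik kE]|/(_ h)[]].
  split=> // y; have := kE y; rewrite !qftE// -scalerAl -scalerAr !scalerA.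
  move: (2 * pi) p0 => c c0 /(congr1 ( *:%R c)); rewrite !scalerA mulfV// scale1r.
  by move=> ->; rewrite -[RHS]scale1r; congr (_ *: _); field.
split=> // y; rewrite !qftE// hE -scalerAl -scalerAr !scalerA.
by move: (2 * pi) p0 => c c0; congr (_ *: _); field.
Qed.

Lemma ft_mulo q f y : qintegrable f -> ft (q \*o f) y =
  ft_comb mu nu (q * moment false false f y) (q * moment false true f y)
    (q * moment true false f y) (q * moment true true f y).
Proof. by move=> intf; rewrite /ft !momentM. Qed.

(** Gives factors without a unit in front the form expected by [convolution_identity], with
    multiplier 1. *)
Lemma ft_mul1 f y : ft f y =
  ft_comb mu nu (1 * moment false false f y) (1 * moment false true f y)
    (1 * moment true false f y) (1 * moment true true f y).
Proof. by rewrite !mul1r. Qed.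

End FourierTransform.

Theorem theorem3p3 (R : realType) (mu nu : quat R) (f g : R * R -> quat R)
  (hmu : mu ^+ 2 = -1) (hnu : nu ^+ 2 = -1) (hmunu : mu * nu + nu * mu = 0)
  (hf : qintegrable f) (hg : qintegrable g) :
  let M := mustard mu nu in
  {ae lebesgue2, forall x, qconv f g x = 4^-1 *: (
        M f g x
      + M f (reflect2 0 1 g) x
      + M f (reflect2 1 0 g) x
      + M f (reflect2 1 1 g) x
      - M (nu \*o f) (nu \*o g) x
      + M (nu \*o f) (nu \*o (reflect2 0 1 g)) x
      - M (nu \*o f) (nu \*o (reflect2 1 0 g)) x
      + M (nu \*o f) (nu \*o (reflect2 1 1 g)) x
      - M (mu \*o (reflect2 0 1 f)) (mu \*o g) x
      - M (mu \*o (reflect2 0 1 f)) (mu \*o (reflect2 0 1 g)) x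
      + M (mu \*o (reflect2 0 1 f)) (mu \*o (reflect2 1 0 g)) x
      + M (mu \*o (reflect2 0 1 f)) (mu \*o (reflect2 1 1 g)) x
      + M ((nu * mu) \*o (reflect2 0 1 f)) ((mu * nu) \*o g) x
      - M ((nu * mu) \*o (reflect2 0 1 f)) ((mu * nu) \*o (reflect2 0 1 g)) x
      - M ((nu * mu) \*o (reflect2 0 1 f)) ((mu * nu) \*o (reflect2 1 0 g)) x
      + M ((nu * mu) \*o (reflect2 0 1 f)) ((mu * nu) \*o (reflect2 1 1 g)) x)}.
Proof.
have ir m n h := @qintegrable_reflect R m n h.
have io q h : qintegrable h -> qintegrable (q \*o h) := @qintegrableM R q h.
(* Both sides are integrable, so it suffices to compare their transforms. *)
move=> M; apply: (ft_unique hmu hnu (k := qconv f g)).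
- have hM := mustardP hmu hnu hmunu; rewrite -/M in hM.
  apply: has_ftZ.
  (* Sixteen signed Mustard convolutions are joined by fifteen additions; each contributes the
     product of the transforms of its factors. *)
  do 15!(apply: has_ftD; last by try apply: has_ftN;
    apply: hM; do ?[exact: hf|exact: hg|apply: io|apply: ir]).
  exact: hM.
- exact: qintegrable_qconv.
- move=> y; cbv beta; rewrite !ft_mulo; do ?[exact: hf|exact: hg|apply: ir].
  rewrite (ft_mul1 _ _ f) (ft_mul1 _ _ g) !(ft_mul1 _ _ (reflect2 _ _ _)).
  rewrite /ft !moment_qconvE// !moment_reflect01// !moment_reflect10//.
  rewrite !moment_reflect11//.
  (* Each real component is an additive map, so the algebraic identity applies to it; [four] turns
     its factor 4 into the quarter of the statement. *)
  have four (s r : R) : s = 4 * r -> r = 4^-1 * s by move=> ->; field.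
  apply: quatP; rewrite ?(qreZ, qiZ, qjZ, qkZ); apply: four.
  + exact: (convolution_identity hmu hnu hmunu (@qreD R) (@qreN R)).
  + exact: (convolution_identity hmu hnu hmunu (@qiD R) (@qiN R)).
  + exact: (convolution_identity hmu hnu hmunu (@qjD R) (@qjN R)).
  + exact: (convolution_identity hmu hnu hmunu (@qkD R) (@qkN R)).
Qed.
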